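(* There is an absolute constant $c>0$ such that the following holds. Let $p_1,p_2,p_3$ be three noncollinear points in the plane, and let $P$ be a set of $n$ points in the plane, distinct from $p_1,p_2,p_3$. Then the number of distinct distances in the set $\{|p_iq| : i\in\{1,2,3\},\ q\in P\}$ is at least $c\,n^{6/11}$; that is, it is $\Omega(n^{6/11})$.
   Context: $|pq|$ denotes the Euclidean distance between points $p,q\in\mathbb{R}^2$. *)

(* Defs.v *)
From Stdlib Require Import Reals Lra List.
Import ListNotations.
Open Scope R_scope.

Definition point := (R * R)%type.

Definition dist (p q : point) : R :=
  sqrt ((fst p - fst q)^2 + (snd p - snd q)^2).

(* three points are collinear iff the signed area of the triangle vanishes *)
Definition collinear (a b c : point) : Prop :=
  (fst b - fst a) * (snd c - snd a) - (snd b - snd a) * (fst c - fst a) = 0.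

Definition dist_list (p1 p2 p3 : point) (P : list point) : list R :=
  flat_map (fun q => [dist p1 q; dist p2 q; dist p3 q]) P.

Definition num_distinct (l : list R) : nat := length (nodup Req_EM_T l).

(* Main.v *)
(** The points are counted through the pairs (q1, q2) with |p3 q1| = |p3 q2|
    and |p1 q1| <> |p1 q2|.  If t distances occur, Cauchy-Schwarz gives at least
    n^2/t - 2n of them.  Such a pair is an incidence between the point
    (|p1 q1|, |p1 q2|) of a t x t grid and a "curve" labelled (|p2 q1|, |p2 q2|).
    The incidence bound needs no crossing lemma because the points form a grid:
    cut it into cells of side B ~ t^(1/3).  Once one fixes on which sides of the
    lines p2p1 and p2p3 the points q1, q2 lie, both |p1 q1| and |p1 q2| are
    monotone in |p3 q1| along a curve, so a curve visits O(t/B) cells; and two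
    points of a cell lie on at most 30 common curves.  Hence
    n^2/t - 2n = O(t^2 (t/B) + t^2 B^2) = O(t^(8/3)).

    The bound 30 is where noncollinearity enters.  Two points on a common curve
    give four points of the plane in a rectangle-like position; in suitable
    coordinates these satisfy a system of four equations in four unknowns, which
    is reduced to a univariate polynomial whose leading coefficient does not
    vanish as soon as the angles at p1 and p3 are not right.  Since a triangle has
    at most one right angle, this holds after relabelling the p_i. *)

From Stdlib Require Import Reals Lra Lia List ClassicalEpsilon Classical.
From mathcomp Require all_boot zify.
Require Import Defs.
Import ListNotations.
Open Scope R_scope.

(** * Cardinality bounds and polynomial functions *)

(** Phrased through duplicate-free lists, so that predicates on reals need neither an enumeration
    nor decidable membership. *)
Definition at_most {A : Type} (K : nat) (S : A -> Prop) : Prop :=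
  forall l, NoDup l -> (forall x, In x l -> S x) -> (length l <= K)%nat.

Lemma at_most_weaken {A : Type} (K L : nat) (S T : A -> Prop) :
  (K <= L)%nat -> (forall x, S x -> T x) -> at_most K T -> at_most L S.
Proof.
intros HKL HST HT l Hl HS.
apply Nat.le_trans with K; [apply HT; auto | exact HKL].
Qed.

Lemma at_most_or {A : Type} (K L : nat) (S T : A -> Prop) :
  at_most K S -> at_most L T -> at_most (K + L) (fun x => S x \/ T x).
Proof.
intros HS HT l Hl Hin.
assert (Hd : forall x, {S x} + {~ S x}) by (intros; apply excluded_middle_informative).
set (b := fun x => if Hd x then true else false).
rewrite <- (filter_length b l).
apply Nat.add_le_mono.
- apply HS; [now apply NoDup_filter |].
  intros x Hx; apply filter_In in Hx; destruct Hx as [_ Hx].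
  unfold b in Hx; destruct (Hd x); [assumption | discriminate].
- apply HT; [now apply NoDup_filter |].
  intros x Hx; apply filter_In in Hx; destruct Hx as [Hx Hb].
  unfold b in Hb; destruct (Hd x); [discriminate |].
  now destruct (Hin x Hx).
Qed.

Lemma length_fibers {A B : Type} (L : nat) (S : A -> Prop) (f : A -> B) :
  (forall y, at_most L (fun x => S x /\ f x = y)) ->
  forall vs l, NoDup l -> (forall x, In x l -> S x /\ In (f x) vs) ->
  (length l <= length vs * L)%nat.
Proof.
intros HL vs; induction vs as [|v vs IH]; intros l Hl Hin.
- destruct l as [|x l]; [apply le_n |].
  now destruct (Hin x (or_introl eq_refl)).
- assert (Hd : forall x, {f x = v} + {f x <> v})
    by (intros; apply excluded_middle_informative).
  set (b := fun x => if Hd x then true else false).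
  rewrite <- (filter_length b l); simpl.
  apply Nat.add_le_mono.
  + apply (HL v); [now apply NoDup_filter |].
    intros x Hx; apply filter_In in Hx; destruct Hx as [Hx Hb].
    unfold b in Hb; destruct (Hd x); [| discriminate].
    split; [now apply Hin | assumption].
  + apply IH; [now apply NoDup_filter |].
    intros x Hx; apply filter_In in Hx; destruct Hx as [Hx Hb].
    unfold b in Hb; destruct (Hd x) as [|n]; [discriminate |].
    destruct (Hin x Hx) as [H1 [H2|H2]]; [now symmetry in H2 | now split].
Qed.

Lemma at_most_fibers {A B : Type} (K L : nat) (S : A -> Prop) (T : B -> Prop) (f : A -> B) :
  (forall x, S x -> T (f x)) -> at_most K T ->
  (forall y, T y -> at_most L (fun x => S x /\ f x = y)) ->
  at_most (K * L) S.
Proof.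
intros HST HT HL l Hl Hin.
assert (Hd : forall x y : B, {x = y} + {x <> y})
  by (intros; apply excluded_middle_informative).
assert (HTv : forall y, In y (nodup Hd (map f l)) -> T y).
{ intros y Hy; apply nodup_In, in_map_iff in Hy.
  destruct Hy as [x [<- Hx]]; auto. }
apply Nat.le_trans with (length (nodup Hd (map f l)) * L)%nat.
- apply (length_fibers L S f); auto.
  + intros y; destruct (classic (T y)) as [Hy|Hy]; [now apply HL |].
    intros [|x l'] _ H; [apply Nat.le_0_l |].
    destruct (H x (or_introl eq_refl)) as [H1 <-]; now apply HST in H1.
  + intros x Hx; split; [now apply Hin |].
    now apply nodup_In, in_map.
- apply Nat.mul_le_mono_r, HT; [apply NoDup_nodup | assumption].
Qed.

Lemma at_most_1 {A : Type} (S : A -> Prop) :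
  (forall x y, S x -> S y -> x = y) -> at_most 1 S.
Proof.
intros H [|x [|y l]] Hl Hin; simpl; try lia.
exfalso; inversion Hl as [|x' l' Hx Hl']; apply Hx.
rewrite (H x y); simpl; auto; apply Hin; simpl; auto.
Qed.

Lemma at_most_image {A B : Type} (K : nat) (S : A -> Prop) (T : B -> Prop) (f : A -> B) :
  (forall x, S x -> T (f x)) -> (forall x y, S x -> S y -> f x = f y -> x = y) ->
  at_most K T -> at_most K S.
Proof.
intros HST Hf HT.
rewrite <- (Nat.mul_1_r K).
apply (at_most_fibers K 1 S T f); auto.
intros y _; apply at_most_1; intros x x' [H1 H2] [H3 H4].
apply Hf; congruence.
Qed.

(* [f] is a polynomial function of degree at most [n] with [n]-th coefficient [c]. *)
Fixpoint is_poly (n : nat) (c : R) (f : R -> R) : Prop :=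
  match n with
  | O => forall x, f x = c
  | S n' => exists g d, is_poly n' c g /\ forall x, f x = d + x * g x
  end.

Lemma is_poly_ext n c f c' f' :
  is_poly n c f -> c = c' -> (forall x, f' x = f x) -> is_poly n c' f'.
Proof.
intros H <- Hf; destruct n as [|n]; simpl in *.
- intros x; now rewrite Hf.
- destruct H as [g [d [Hg H]]]; exists g, d; split; [assumption |].
  intros x; now rewrite Hf.
Qed.

Lemma is_poly_const c : is_poly 0 c (fun _ => c).
Proof. now intros x. Qed.

Lemma is_poly_id : is_poly 1 1 (fun x => x).
Proof. exists (fun _ => 1), 0; split; [apply is_poly_const | intros x; ring]. Qed.

Lemma is_poly_raise n c f : is_poly n c f -> is_poly (S n) 0 f.
Proof.
revert f; induction n as [|n IH]; intros f H.
- exists (fun _ => 0), c; split; [apply is_poly_const |].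
  intros x; rewrite (H x); ring.
- destruct H as [g [d [Hg H]]]; exists g, d; auto.
Qed.

Lemma is_poly_raise_to n m c f : is_poly n c f -> (n < m)%nat -> is_poly m 0 f.
Proof.
intros H; induction 1 as [|m Hm IH]; eapply is_poly_raise; eassumption.
Qed.

Lemma is_poly_add n c d f g :
  is_poly n c f -> is_poly n d g -> is_poly n (c + d) (fun x => f x + g x).
Proof.
revert f g; induction n as [|n IH]; intros f g Hf Hg.
- intros x; now rewrite (Hf x), (Hg x).
- destruct Hf as [f' [cf [Hf' Hf]]], Hg as [g' [cg [Hg' Hg]]].
  exists (fun x => f' x + g' x), (cf + cg); split; [now apply IH |].
  intros x; rewrite Hf, Hg; ring.
Qed.

Lemma is_poly_scale n c d f :
  is_poly n c f -> is_poly n (d * c) (fun x => d * f x).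
Proof.
revert f; induction n as [|n IH]; intros f Hf.
- intros x; now rewrite (Hf x).
- destruct Hf as [f' [cf [Hf' Hf]]].
  exists (fun x => d * f' x), (d * cf); split; [now apply IH |].
  intros x; rewrite Hf; ring.
Qed.

Lemma is_poly_sub n c d f g :
  is_poly n c f -> is_poly n d g -> is_poly n (c - d) (fun x => f x - g x).
Proof.
intros Hf Hg.
apply (is_poly_ext n (c + -1 * d) (fun x => f x + -1 * g x)); [| ring | intros; ring].
apply is_poly_add; [assumption | now apply is_poly_scale].
Qed.

Lemma is_poly_mul n m c d f g :
  is_poly n c f -> is_poly m d g -> is_poly (n + m) (c * d) (fun x => f x * g x).
Proof.
revert f; induction n as [|n IH]; intros f Hf Hg.
- apply (is_poly_ext m (c * d) (fun x => c * g x)); [now apply is_poly_scale | reflexivity |].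
  intros x; now rewrite (Hf x).
- destruct Hf as [f' [cf [Hf' Hf]]].
  apply (is_poly_ext (S n + m) (0 + c * d) (fun x => cf * g x + x * (f' x * g x)));
    [| ring | intros; rewrite Hf; ring].
  apply is_poly_add.
  + apply (is_poly_raise_to m _ (cf * d)); [now apply is_poly_scale | lia].
  + exists (fun x => f' x * g x), 0; split; [now apply IH | intros; ring].
Qed.

Lemma is_poly_factor n c f a :
  is_poly (S n) c f -> exists g, is_poly n c g /\ forall x, f x = f a + (x - a) * g x.
Proof.
revert f; induction n as [|n IH]; intros f [g [d [Hg Hf]]].
- exists (fun _ => c); split; [apply is_poly_const |].
  intros x; rewrite !Hf, !(Hg _); ring.
- destruct (IH g Hg) as [h [Hh Hgh]].
  exists (fun x => g a + x * h x); split.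
  + exists h, (g a); auto.
  + intros x; rewrite !Hf, (Hgh x); ring.
Qed.

(** Each root splits off a linear factor, and the quotient keeps the leading coefficient [c]. *)
Lemma at_most_roots n c f :
  is_poly n c f -> c <> 0 -> at_most n (fun x => f x = 0).
Proof.
intros Hf Hc; revert f Hf; induction n as [|n IH]; intros f Hf [|a l] Hl Hin;
  simpl; try lia.
- destruct Hc; rewrite <- (Hf a); apply Hin; simpl; auto.
- destruct (is_poly_factor n c f a Hf) as [g [Hg Hfg]].
  inversion Hl as [|a' l' Ha Hl']; subst.
  apply le_n_S, (IH g Hg l Hl').
  intros x Hx.
  assert (H0 : f a = 0) by (apply Hin; simpl; auto).
  assert (H1 : f x = 0) by (apply Hin; simpl; auto).
  rewrite Hfg, H0, Rplus_0_l in H1.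
  destruct (Rmult_integral _ _ H1) as [H|H]; [| assumption].
  destruct Ha; replace a with x by lra; assumption.
Qed.

(** Witnesses chosen for distinct elements are distinct, because [y] determines [x] through [r]. A
    relation is used since a curve label has no canonical quadruple of points realizing it. *)
Lemma at_most_relation {A B : Type} (K : nat) (S : A -> Prop) (T : B -> Prop)
    (r : A -> B -> Prop) :
  (forall x, S x -> exists y, r x y /\ T y) ->
  (forall x x' y, r x y -> r x' y -> x = x') ->
  at_most K T -> at_most K S.
Proof.
intros HST Hr HT l Hl Hin.
assert (Hex : exists l', length l' = length l /\ NoDup l' /\
  forall y, In y l' -> T y /\ exists x, In x l /\ r x y).
{ clear HT; induction l as [|x l IH].
  - exists nil; repeat split; [constructor | easy..].
  - inversion Hl as [|x' l0 Hx Hl']; subst.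
    destruct IH as [l' [Hlen [Hnd Hl2]]]; [assumption | intros; apply Hin; now right |].
    destruct (HST x (Hin x (or_introl eq_refl))) as [y [Hxy Hy]].
    exists (y :: l'); split; [simpl; congruence | split].
    + constructor; [| assumption].
      intros Hy'; destruct (Hl2 y Hy') as [_ [x' [Hx' Hxy']]].
      apply Hx; now rewrite (Hr x x' y).
    + intros y' [<-|Hy']; [split; [assumption | exists x; simpl; auto] |].
      destruct (Hl2 y' Hy') as [HTy [x' [Hx' Hxy']]].
      split; [assumption | exists x'; simpl; auto]. }
destruct Hex as [l' [<- [Hnd Hl']]].
apply HT; [assumption | intros y Hy; now apply Hl'].
Qed.

(** * Two points lie on boundedly many common curves *)

(* The unknowns describe four points (m + i al + j be, H + i a + j b + i j k) with
   signs i, j, where [i = -1] exchanges q1 with q2 and [j = -1] exchanges the two pairs.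
   The first three equations say that |p3 q1| = |p3 q2| for both pairs and that the pairs
   lie on the same curve, for p3 = (0, 0), p2 = (D, 0) and p1 = (p f, f); that the second
   coordinates are affine in [al] and [be] expresses the prescribed differences of the
   squared distances to p1, and the last equation prescribes their sum. *)
Definition rectangle_system (p r f D a0 b0 k C : R) (s : R * R * R * R) : Prop :=
  let '(al, be, m, H) := s in
  let a := a0 - p * al in
  let b := b0 + r * be in
  al * m + a * H + k * b = 0 /\
  al * be + a * b + k * H = 0 /\
  be * (m - D) + b * H + k * a = 0 /\
  m*m + al*al + be*be + H*H + a*a + b*b + k*k - 2 * (p * f * m + f * H) = C.

Definition sol_al (s : R * R * R * R) : R := fst (fst (fst s)).
Definition sol_be (s : R * R * R * R) : R := snd (fst (fst s)).

Lemma sum_sqr_pos x y : x <> 0 \/ y <> 0 -> 0 < x^2 + y^2.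
Proof. intros [H|H]; nra. Qed.

Lemma is_poly_linear c d : is_poly 1 c (fun x => d + c * x).
Proof. exists (fun _ => c), d; split; [apply is_poly_const | intros; ring]. Qed.

Lemma is_poly_quadratic c d e : is_poly 2 c (fun x => e + d * x + c * x^2).
Proof.
exists (fun x => d + c * x), e; split; [apply is_poly_linear | intros; ring].
Qed.

(* For [k = 0] the four points form a rectangle; [be], [m] and [H] are rational
   functions of [al], with the positive denominator [N] and the denominator [s]. *)
Lemma rectangle_system_k0 p r f D a0 b0 C :
  p * r <> 1 -> a0 <> 0 -> b0 <> 0 ->
  at_most 6 (rectangle_system p r f D a0 b0 0 C).
Proof.
intros Hpr Ha0 Hb0.
assert (Hsol : forall s, rectangle_system p r f D a0 b0 0 C s ->
  let '(al, be, m, H) := s in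
  let a := a0 - p * al in let N := a*a + al*al in let s := al + r * a in
  0 < N /\ s <> 0 /\ be * s = - (a * b0) /\
  m * N = a*a * D /\ H * N = - (a * al * D)).
{ intros [[[al be] m] H]; simpl.
  set (a := a0 - p * al); set (b := b0 + r * be).
  intros [E1 [E2 [E3 E4]]].
  assert (HN : 0 < a*a + al*al).
  { replace (a*a + al*al) with (a^2 + al^2) by ring; apply sum_sqr_pos; destruct (Req_dec al 0) as [E|E]; [left | now right].
    unfold a; rewrite E; lra. }
  assert (Ebs : be * (al + r * a) = - (a * b0)).
  { unfold b in E2; lra. }
  assert (Hs : al + r * a <> 0).
  { intros E; rewrite E in Ebs.
    assert (Ea : a = 0) by (destruct (Rmult_integral a b0); lra).
    rewrite Ea in E, HN; nra. }
  assert (Ebb : b * (al + r * a) = b0 * al).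
  { unfold b; replace ((b0 + r * be) * (al + r * a))
      with (b0 * (al + r * a) + r * (be * (al + r * a))) by ring.
    rewrite Ebs; ring. }
  assert (E5 : - a * m + al * H = - a * D).
  { apply (Rmult_eq_reg_l b0); [| assumption].
    assert (E6 : (be * (al + r * a)) * (m - D) + (b * (al + r * a)) * H = 0).
    { transitivity ((al + r * a) * (be * (m - D) + b * H + 0 * a)); [ring |].
      rewrite E3; ring. }
    rewrite Ebs, Ebb in E6; lra. }
  repeat split; auto.
  - transitivity (al * (al * m + a * H + 0 * b) - a * (- a * m + al * H)); [ring |].
    rewrite E1, E5; ring.
  - transitivity (a * (al * m + a * H + 0 * b) + al * (- a * m + al * H)); [ring |].
    rewrite E1, E5; ring. }
set (fa := fun al => a0 - p * al).
set (fN := fun al => (a0 - p * al) * (a0 - p * al) + al * al).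
set (fs := fun al => al + r * (a0 - p * al)).
(* [F] is the fourth equation after substitution of the rational expressions, multiplied by
   [fN * fs^2]. Only its first summand reaches degree 6. *)
set (F := fun al => (fN al * fs al) * (fN al * fs al)
   + ((fN al * fN al) * (b0^2)
   + (fs al * fs al) * ((D^2 - 2 * p * f * D) * (fa al * fa al)
      + 2 * f * D * (fa al * al) - C * fN al))).
assert (PN : is_poly 2 (1 + p^2) fN).
{ eapply is_poly_ext; [apply (is_poly_quadratic (1 + p^2) (- 2 * a0 * p) (a0^2)) | ring |].
  intros x; unfold fN; ring. }
assert (Ps : is_poly 1 (1 - p * r) fs).
{ eapply is_poly_ext; [apply (is_poly_linear (1 - p * r) (r * a0)) | ring |].
  intros x; unfold fs; ring. }
assert (Pq : is_poly 2 ((D^2 - 2 * p * f * D) * p^2 - 2 * f * D * p - C * (1 + p^2))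
  (fun al => (D^2 - 2 * p * f * D) * (fa al * fa al)
      + 2 * f * D * (fa al * al) - C * fN al)).
{ eapply is_poly_ext; [apply (is_poly_quadratic
     ((D^2 - 2 * p * f * D) * p^2 - 2 * f * D * p - C * (1 + p^2))
     ((D^2 - 2 * p * f * D) * (- 2 * a0 * p) + 2 * f * D * a0 + C * (2 * a0 * p))
     ((D^2 - 2 * p * f * D) * a0^2 - C * a0^2)) | ring |].
  intros x; unfold fN, fa; ring. }
assert (PF : is_poly 6 (((1 + p^2) * (1 - p * r)) * ((1 + p^2) * (1 - p * r))) F).
{ eapply is_poly_ext with (c := _ + 0);
    [| rewrite Rplus_0_r; reflexivity | intros x; unfold F; reflexivity].
  apply is_poly_add.
  - apply (is_poly_mul 3 3); apply (is_poly_mul 2 1); assumption.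
  - apply (is_poly_raise_to 4) with
      (c := (1 + p^2) * (1 + p^2) * b0^2 + (1 - p * r) * (1 - p * r)
        * ((D^2 - 2 * p * f * D) * p^2 - 2 * f * D * p - C * (1 + p^2))); [| lia].
    apply is_poly_add.
    + apply (is_poly_mul 4 0); [apply (is_poly_mul 2 2); assumption | apply is_poly_const].
    + apply (is_poly_mul 2 2); [apply (is_poly_mul 1 1); assumption | assumption]. }
apply (at_most_image 6 _ (fun al => F al = 0) sol_al).
- intros [[[al be] m] H] Hs; generalize (Hsol _ Hs); revert Hs; unfold sol_al; simpl.
  intros [_ [_ [_ E4]]] [HN [Hs [E1 [E2 E3]]]].
  unfold F, fN, fs, fa.
  set (a := a0 - p * al) in *.
  assert (HN' : a*a + al*al <> 0) by lra.
  replace be with (- (a * b0) / (al + r * a)) in E4 by (rewrite <- E1; field; assumption).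
  replace m with (a*a * D / (a*a + al*al)) in E4 by (rewrite <- E2; field; assumption).
  replace H with (- (a * al * D) / (a*a + al*al)) in E4 by (rewrite <- E3; field; assumption).
  rewrite <- E4; field; split; assumption.
- intros [[[al be] m] H] [[[al' be'] m'] H'] Hs Hs'.
  generalize (Hsol _ Hs) (Hsol _ Hs'); unfold sol_al; simpl.
  intros [HN [Hs0 [E1 [E2 E3]]]] [_ [_ [E1' [E2' E3']]]] <-.
  set (a := a0 - p * al) in *.
  assert (HN' : a*a + al*al <> 0) by lra.
  repeat f_equal.
  + apply (Rmult_eq_reg_r (al + r * a)); congruence.
  + apply (Rmult_eq_reg_r (a*a + al*al)); congruence.
  + apply (Rmult_eq_reg_r (a*a + al*al)); congruence.
- apply (at_most_roots 6 _ F PF).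
  assert (1 - p * r <> 0) by lra.
  assert (0 < 1 + p^2) by nra.
  repeat apply Rmult_integral_contrapositive_currified; lra.
Qed.

(** The left side is the resultant (Sylvester determinant) of the two quadratics. *)
Lemma quadratics_common_root u2 u1 u0 v2 v1 v0 x :
  u2 * (x * x) + u1 * x + u0 = 0 -> v2 * (x * x) + v1 * x + v0 = 0 ->
  (u2 * v0 - u0 * v2) * (u2 * v0 - u0 * v2)
  - (u2 * v1 - u1 * v2) * (u1 * v0 - u0 * v1) = 0.
Proof.
intros Hu Hv.
replace u0 with (- (u2 * (x * x) + u1 * x)) by lra.
replace v0 with (- (v2 * (x * x) + v1 * x)) by lra.
ring.
Qed.

(* Eliminating [m] and [H] leaves two equations that are quadratic in [al], with
   coefficients [U2, U1, U0] and [V2, V1, V0] polynomial in [be].  Their resultant [Res]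
   in [al] has degree 12 in [be]; its leading coefficient is the resultant of the
   leading coefficients in [be], the second of which is
   [(1 + r^2) ((al + r a)^2 + k^2)], with zeros at [al + r a = +- i k]. *)
Lemma rectangle_system_be_neq0 p r f D a0 b0 k C :
  k <> 0 -> p <> 0 -> p * r <> 1 ->
  at_most 24 (fun s => rectangle_system p r f D a0 b0 k C s /\ sol_be s <> 0).
Proof.
intros Hk Hp Hpr.
set (c := fun be => - p * b0 + (1 - p * r) * be).
set (b := fun be => b0 + r * be).
(* The second equation gives [- k * H], and then the third gives [k * be * m], as affine functions
   of [al]; [M1] and [M0] are the coefficients of the latter. The [U] come from the first equation
   times [- k * be], the [V] from the fourth times [(k * be)^2]. *)
set (M1 := fun be => b be * c be + k^2 * p).
set (M0 := fun be => - k^2 * a0 + k * D * be + a0 * (b be * b be)).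
set (U2 := fun be => -1 * (c be * (p * be + b be)) - k^2 * p).
set (U1 := fun be => a0 * (c be * be) - a0 * (b be * (p * be + b be)) + (k^2 * a0 + - k * D * be)).
set (U0 := fun be => a0^2 * (b be * be) - k^2 * (be * b be)).
set (V2 := fun be => M1 be * M1 be + ((be * be) * (c be * c be) + k^2 * (1 + p^2) * (be * be))).
set (V1 := fun be => 2 * (M1 be * M0 be) + ((2 * a0) * ((be * be) * (c be * b be))
   + ((-2 * k^2 * a0 * p) * (be * be) + ((2 * f * k) * ((be * be) * c be)
     - 2 * p * f * k * (be * M1 be))))).
set (V0 := fun be => M0 be * M0 be + (k^2 * ((be * be) * (be * be))
   + (k^2 * ((be * be) * (b be * b be)) + (a0^2 * ((be * be) * (b be * b be))
   + ((k^2 * (a0^2 + k^2 - C)) * (be * be)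
     + ((2 * f * k * a0) * ((be * be) * b be) - 2 * p * f * k * (be * M0 be))))))).
set (Res := fun be => (U2 be * V0 be - U0 be * V2 be) * (U2 be * V0 be - U0 be * V2 be)
   - (U2 be * V1 be - U1 be * V2 be) * (U1 be * V0 be - U0 be * V1 be)).
assert (Pi : is_poly 1 1 (fun be => be)) by apply is_poly_id.
assert (Pii : is_poly 2 (1 * 1) (fun be => be * be)) by (apply (is_poly_mul 1 1); assumption).
assert (Pc : is_poly 1 (1 - p * r) c) by apply is_poly_linear.
assert (Pb : is_poly 1 r b) by apply is_poly_linear.
assert (Pg : is_poly 1 (p * 1 + r) (fun be => p * be + b be)).
{ apply is_poly_add; [apply is_poly_scale |]; assumption. }
assert (Pcst : forall u, is_poly 2 0 (fun _ => u)).
{ intros u; apply (is_poly_raise_to 0) with u; [apply is_poly_const | lia]. }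
assert (PM1 : is_poly 2 (r * (1 - p * r) + 0) M1).
{ apply is_poly_add; [apply (is_poly_mul 1 1); assumption | apply Pcst]. }
assert (PM0 : is_poly 2 (0 + a0 * (r * r)) M0).
{ apply is_poly_add.
  - apply (is_poly_raise_to 1) with (k * D); [apply is_poly_linear | lia].
  - apply is_poly_scale, (is_poly_mul 1 1); assumption. }
assert (PU2 : is_poly 2 (-1 * ((1 - p * r) * (p * 1 + r)) - 0) U2).
{ apply is_poly_sub; [| apply Pcst].
  apply is_poly_scale, (is_poly_mul 1 1); assumption. }
assert (PU1 : is_poly 2 (a0 * ((1 - p * r) * 1) - a0 * (r * (p * 1 + r)) + 0) U1).
{ apply is_poly_add; [apply is_poly_sub |].
  - apply is_poly_scale, (is_poly_mul 1 1); assumption.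
  - apply is_poly_scale, (is_poly_mul 1 1); assumption.
  - apply (is_poly_raise_to 1) with (- k * D); [apply is_poly_linear | lia]. }
assert (PU0 : is_poly 2 (a0^2 * (r * 1) - k^2 * (1 * r)) U0).
{ apply is_poly_sub; apply is_poly_scale, (is_poly_mul 1 1); assumption. }
assert (P4 : forall u, is_poly 4 0 (fun be => u * (be * be))).
{ intros u; apply (is_poly_raise_to 2) with (u * (1 * 1)); [now apply is_poly_scale | lia]. }
assert (PV2 : is_poly 4 ((r * (1 - p * r) + 0) * (r * (1 - p * r) + 0)
   + ((1 * 1) * ((1 - p * r) * (1 - p * r)) + 0)) V2).
{ apply is_poly_add; [| apply is_poly_add; [| apply P4]].
  - apply (is_poly_mul 2 2); assumption.
  - apply (is_poly_mul 2 2); [assumption |]; apply (is_poly_mul 1 1); assumption. }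
assert (PV1 : is_poly 4 (2 * ((r * (1 - p * r) + 0) * (0 + a0 * (r * r)))
   + ((2 * a0) * ((1 * 1) * ((1 - p * r) * r)) + (0 + (0 - 0)))) V1).
{ apply is_poly_add; [| apply is_poly_add; [| apply is_poly_add; [| apply is_poly_sub]]].
  - apply is_poly_scale, (is_poly_mul 2 2); assumption.
  - apply is_poly_scale, (is_poly_mul 2 2); [assumption |]; apply (is_poly_mul 1 1); assumption.
  - apply P4.
  - eapply (is_poly_raise_to 3); [| lia].
    apply is_poly_scale, (is_poly_mul 2 1); eassumption.
  - eapply (is_poly_raise_to 3); [| lia].
    apply is_poly_scale, (is_poly_mul 1 2); eassumption. }
assert (PV0 : is_poly 4 ((0 + a0 * (r * r)) * (0 + a0 * (r * r))
   + (k^2 * ((1 * 1) * (1 * 1)) + (k^2 * ((1 * 1) * (r * r))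
     + (a0^2 * ((1 * 1) * (r * r)) + (0 + (0 - 0)))))) V0).
{ apply is_poly_add; [| apply is_poly_add; [| apply is_poly_add; [| apply is_poly_add;
    [| apply is_poly_add; [| apply is_poly_sub]]]]].
  - apply (is_poly_mul 2 2); assumption.
  - apply is_poly_scale, (is_poly_mul 2 2); assumption.
  - apply is_poly_scale, (is_poly_mul 2 2); [assumption |]; apply (is_poly_mul 1 1); assumption.
  - apply is_poly_scale, (is_poly_mul 2 2); [assumption |]; apply (is_poly_mul 1 1); assumption.
  - apply P4.
  - eapply (is_poly_raise_to 3); [| lia].
    apply is_poly_scale, (is_poly_mul 2 1); eassumption.
  - eapply (is_poly_raise_to 3); [| lia].
    apply is_poly_scale, (is_poly_mul 1 2); eassumption. }
assert (PRes : is_poly 12 (k^2 * (1 - p * r)^2 * (1 + r^2)^4 * (k^2 * p^2 + a0^2)) Res).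
{ eapply is_poly_ext; [| | reflexivity].
  - apply (is_poly_sub 12).
    + apply (is_poly_mul 6 6); apply (is_poly_sub 6);
        first [apply (is_poly_mul 2 4); eassumption].
    + apply (is_poly_mul 6 6); apply (is_poly_sub 6);
        first [apply (is_poly_mul 2 4); eassumption].
  - ring. }
assert (Hred : forall al be m H, rectangle_system p r f D a0 b0 k C (al, be, m, H) ->
  - k * H = al * c be + a0 * b be /\ (k * be) * m = M1 be * al + M0 be).
{ intros al be m H [_ [E2 [E3 _]]]; unfold M1, M0, c, b.
  assert (EH : - k * H = al * be + (a0 - p * al) * (b0 + r * be)) by lra.
  split; [rewrite EH; ring |].
  transitivity (k * (be * (m - D) + (b0 + r * be) * H + k * (a0 - p * al))
    + (b0 + r * be) * (- k * H) - k * k * (a0 - p * al) + k * be * D); [ring |].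
  rewrite E3, EH; ring. }
assert (Hal : forall al be m H, rectangle_system p r f D a0 b0 k C (al, be, m, H) ->
  V2 be * (al * al) + V1 be * al + V0 be = 0).
{ intros al be m H Hs; destruct (Hred _ _ _ _ Hs) as [EH Em].
  destruct Hs as [_ [_ [_ E4]]].
  transitivity ((M1 be * al + M0 be) * (M1 be * al + M0 be)
    + (be * be) * (al * c be + a0 * b be) * (al * c be + a0 * b be)
    + k * k * be * be * (al * al + be * be + (a0 - p * al) * (a0 - p * al)
        + b be * b be + k * k)
    - 2 * p * f * k * be * (M1 be * al + M0 be)
    + 2 * f * k * be * be * (al * c be + a0 * b be)
    - k * k * be * be * C); [unfold V2, V1, V0; ring |].
  rewrite <- EH, <- Em, <- E4; unfold b; ring. }
assert (HalU : forall al be m H, rectangle_system p r f D a0 b0 k C (al, be, m, H) ->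
  U2 be * (al * al) + U1 be * al + U0 be = 0).
{ intros al be m H Hs; destruct (Hred _ _ _ _ Hs) as [EH Em].
  destruct Hs as [E1 [E2 [E3 _]]].
  set (a := a0 - p * al) in *; fold (b be) in E1, E2, E3.
  transitivity (- (k * be * (al * m + a * H + k * b be))); [| rewrite E1; ring].
  transitivity (- (al * (M1 be * al + M0 be) - be * a * (al * c be + a0 * b be)
    + k * k * be * b be)); [| rewrite <- EH, <- Em; ring].
  unfold U2, U1, U0, M1, M0, a, c, b; ring. }
assert (HV2 : forall be, be <> 0 -> V2 be <> 0).
{ intros be Hbe.
  assert (H1 : 0 < k * k) by nra.
  assert (H2 : 0 < be * be) by nra.
  assert (H3 : 0 < k * k * (be * be) * (1 + p * p)).
  { apply Rmult_lt_0_compat; [apply Rmult_lt_0_compat; assumption | nra]. }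
  assert (H4 : 0 <= (M1 be)^2) by apply pow2_ge_0.
  assert (H5 : 0 <= (be * c be)^2) by apply pow2_ge_0.
  replace (V2 be) with ((M1 be)^2 + ((be * c be)^2 + k * k * (be * be) * (1 + p * p)))
    by (unfold V2; ring).
  lra. }
(* Twelve values of [be], each with at most two of [al] since [V2 be > 0]; then [m] and [H] are
   determined, as [k * be] and [k] are nonzero. *)
apply (at_most_fibers 12 2 _ (fun be => Res be = 0 /\ be <> 0) sol_be).
- intros [[[al be] m] H] [Hs Hbe]; unfold sol_be in *; simpl in *; split; [| assumption].
  apply quadratics_common_root with al; [eapply HalU | eapply Hal]; eassumption.
- apply (at_most_weaken 12 12 _ (fun be => Res be = 0)); [lia | tauto |].
  apply (at_most_roots 12 _ Res PRes).
  assert (0 < 1 + r^2) by nra.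
  assert (0 < (k * p)^2 + a0^2) by (apply sum_sqr_pos; left; nra).
  assert (k^2 * p^2 + a0^2 <> 0) by nra.
  repeat apply Rmult_integral_contrapositive_currified; try apply pow_nonzero; lra.
- intros be [_ Hbe].
  apply (at_most_image 2 _ (fun al => V0 be + V1 be * al + V2 be * al^2 = 0) sol_al).
  + intros [[[al be'] m] H] [[Hs _] E]; unfold sol_be, sol_al in *; simpl in E; subst be'.
    rewrite <- (Hal _ _ _ _ Hs); simpl; ring.
  + intros [[[al be1] m] H] [[[al' be2] m'] H'] [[Hs _] E] [[Hs' _] E'];
      unfold sol_be, sol_al in *; simpl in *; subst be1 be2; intros <-.
    destruct (Hred _ _ _ _ Hs) as [EH Em], (Hred _ _ _ _ Hs') as [EH' Em'].
    repeat f_equal.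
    * apply (Rmult_eq_reg_l (k * be)); [congruence |].
      now apply Rmult_integral_contrapositive_currified.
    * apply (Rmult_eq_reg_l (- k)); [congruence | lra].
  + eapply at_most_roots; [apply is_poly_quadratic | now apply HV2].
Qed.

(** With [be = 0] the third equation loses [m]. If [a = 0], then [al] and [H] are fixed and [m]
    solves a quadratic. Otherwise [b0^2 = k^2], the hypothesis on [a0] excludes [al = 0], and [al]
    solves a quartic that determines the rest. *)
Lemma rectangle_system_be_eq0 p r f D a0 b0 k C :
  k <> 0 -> p <> 0 -> a0 * a0 <> k * k ->
  at_most 6 (fun s => rectangle_system p r f D a0 b0 k C s /\ sol_be s = 0).
Proof.
intros Hk Hp Ha0.
set (A := fun s => rectangle_system p r f D a0 b0 k C s /\ sol_be s = 0).
apply (at_most_weaken (2 + 4) 6 _ (fun s => (A s /\ a0 - p * sol_al s = 0) \/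
  (A s /\ a0 - p * sol_al s <> 0))); [lia | intros s Hs; tauto |].
apply at_most_or.
- apply (at_most_image 2 _ (fun m =>
    ((a0 / p)^2 + b0^2 + k^2 - C) + (- 2 * p * f) * m + 1 * m^2 = 0)
    (fun s => snd (fst s))).
  + intros [[[al be] m] H] [[Hs E] Ea]; unfold sol_be, sol_al in *; simpl in *; subst be.
    destruct Hs as [_ [E2 [_ E4]]].
    rewrite Ea in E2, E4.
    assert (EH : H = 0) by (apply (Rmult_eq_reg_l k); lra).
    replace (a0 / p) with al by (apply (Rmult_eq_reg_l p); [field_simplify; lra | lra]).
    rewrite <- E4, EH; ring.
  + intros [[[al be] m] H] [[[al' be'] m'] H'] [[Hs E] Ea] [[Hs' E'] Ea'];
      unfold sol_be, sol_al in *; simpl in *; subst be be'; intros <-.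
    destruct Hs as [_ [E2 [_ _]]], Hs' as [_ [E2' [_ _]]].
    rewrite Ea in E2; rewrite Ea' in E2'.
    repeat f_equal; [apply (Rmult_eq_reg_l p); lra | apply (Rmult_eq_reg_l k); lra].
  + eapply at_most_roots; [apply is_poly_quadratic | lra].
- assert (Hsol : forall al m H, A (al, 0, m, H) -> a0 - p * al <> 0 ->
    b0 * b0 = k * k /\ al <> 0 /\ k * H = - ((a0 - p * al) * b0)
    /\ k * (al * m) = b0 * ((a0 - p * al) * (a0 - p * al) - k * k)).
  { intros al m H [[E1 [E2 [E3 _]]] _] Ha; cbv zeta in E1, E2, E3.
    replace (b0 + r * 0) with b0 in E1, E2, E3 by ring.
    set (a := a0 - p * al) in *.
    assert (EH : k * H = - (a * b0)) by lra.
    assert (Eb : b0 * b0 = k * k).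
    { apply (Rmult_eq_reg_l a); [| assumption].
      transitivity (- b0 * (k * H) - k * (0 * (m - D))); [rewrite EH; ring |].
      transitivity (- k * (0 * (m - D) + b0 * H + k * a) + k * k * a); [ring |].
      rewrite E3; ring. }
    assert (Em : k * (al * m) = b0 * (a * a - k * k)).
    { transitivity (k * (al * m + a * H + k * b0) - a * (k * H) - k * k * b0); [ring |].
      rewrite E1, EH; ring. }
    repeat split; auto.
    intros E; unfold a in Em; rewrite E in Em.
    assert (Em' : b0 * (a0 * a0 - k * k) = 0) by lra.
    destruct (Rmult_integral _ _ Em') as [E0|E0]; [| lra].
    rewrite E0 in Eb; nra. }
  set (a := fun al => a0 - p * al).
  set (N := fun al => - k * k + a0 * a0 + (-2 * a0 * p) * al + (p * p) * al^2).
  (* [F] is the fourth equation times [al^2], after replacing [al * m] by [b0 * N al / k], [H] by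
     [- (a al * b0) / k] and [b0^2] by [k^2]; its leading coefficient is [(1 + p^2)^2]. *)
  set (F := fun al => N al * N al + ((al * al) * (al * al) + (((al * al) * (2 * (a al * a al)))
     + (al * al * (k * k + k * k - C) + (2 * f * b0 / k * (al * al * a al)
     - 2 * p * f * b0 / k * (al * N al)))))).
  assert (PN : is_poly 2 (p * p) N) by apply is_poly_quadratic.
  assert (Pi : is_poly 1 1 (fun al => al)) by apply is_poly_id.
  assert (Pii : is_poly 2 (1 * 1) (fun al => al * al)) by (apply (is_poly_mul 1 1); assumption).
  assert (Pa : is_poly 1 (- p) a).
  { eapply is_poly_ext; [apply (is_poly_linear (- p) a0) | ring | intros; unfold a; ring]. }
  assert (PF : is_poly 4 ((p * p) * (p * p) + ((1 * 1) * (1 * 1)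
    + (((1 * 1) * (2 * (- p * - p))) + (0 + (0 - 0))))) F).
  { apply is_poly_add; [| apply is_poly_add; [| apply is_poly_add; [| apply is_poly_add;
      [| apply is_poly_sub]]]].
    - apply (is_poly_mul 2 2); assumption.
    - apply (is_poly_mul 2 2); assumption.
    - apply (is_poly_mul 2 2); [assumption |]; apply is_poly_scale, (is_poly_mul 1 1); assumption.
    - eapply (is_poly_raise_to 2); [| lia].
      apply (is_poly_mul 2 0); [eassumption | apply is_poly_const].
    - eapply (is_poly_raise_to 3); [| lia].
      apply is_poly_scale, (is_poly_mul 2 1); eassumption.
    - eapply (is_poly_raise_to 3); [| lia].
      apply is_poly_scale, (is_poly_mul 1 2); eassumption. }
  apply (at_most_image 4 _ (fun al => F al = 0) sol_al).
  + intros [[[al be] m] H] [HA Ha]; unfold sol_al in *; simpl in *.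
    assert (Ebe : be = 0) by apply HA; subst be.
    destruct (Hsol al m H HA Ha) as [Eb [Hal [EH Em]]].
    destruct HA as [[_ [_ [_ E4]]] _].
    fold (a al) in *.
    assert (EN : N al = a al * a al - k * k) by (unfold N, a; ring).
    assert (EH' : H = - (a al * b0) / k) by (apply (Rmult_eq_reg_l k); [rewrite EH; field |]; lra).
    assert (Em' : al * m = b0 * N al / k).
    { rewrite EN; apply (Rmult_eq_reg_l k); [rewrite Em; field |]; lra. }
    assert (EHH : H * H = a al * a al).
    { rewrite EH'; transitivity (a al * a al * (b0 * b0) / (k * k));
        [| rewrite Eb]; field; lra. }
    assert (Emm : (al * m) * (al * m) = N al * N al).
    { rewrite Em'; transitivity (N al * N al * (b0 * b0) / (k * k));
        [| rewrite Eb]; field; lra. }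
    transitivity ((al * m) * (al * m) + al * al * (al * al) + al * al * (H * H)
      + al * al * (a al * a al) + al * al * (b0 * b0 + k * k - C)
      - 2 * f * (al * al * H) - 2 * p * f * al * (al * m)).
    * rewrite Emm, EHH, Eb, Em', EH'; unfold F; field; assumption.
    * rewrite <- E4; ring.
  + intros [[[al be] m] H] [[[al' be'] m'] H'] [HA Ha] [HA' Ha']; unfold sol_al in *; simpl in *.
    assert (Ebe : be = 0) by apply HA; subst be.
    assert (Ebe : be' = 0) by apply HA'; subst be'.
    intros <-.
    destruct (Hsol _ _ _ HA Ha) as [Eb [Hal [EH Em]]].
    destruct (Hsol _ _ _ HA' Ha') as [_ [_ [EH' Em']]].
    repeat f_equal.
    * apply (Rmult_eq_reg_l al); [| assumption].
      apply (Rmult_eq_reg_l k); congruence.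
    * apply (Rmult_eq_reg_l k); congruence.
  + apply (at_most_roots 4 _ F PF); nra.
Qed.

(** For [k = 0] the hypotheses say that [a0] and [b0] are nonzero; otherwise the cases [be <> 0] and
    [be = 0] contribute 24 + 6. *)
Lemma rectangle_system_finite p r f D a0 b0 k C :
  p <> 0 -> p * r <> 1 -> a0 + k <> 0 -> a0 - k <> 0 -> b0 + k <> 0 \/ b0 - k <> 0 ->
  at_most 30 (rectangle_system p r f D a0 b0 k C).
Proof.
intros Hp Hpr Ha1 Ha2 Hb.
destruct (Req_dec k 0) as [->|Hk].
- apply (at_most_weaken 6 30 _ (rectangle_system p r f D a0 b0 0 C)); [lia | auto |].
  apply rectangle_system_k0; lra.
- assert (Ha0 : a0 * a0 <> k * k).
  { intros E; apply (Rmult_integral_contrapositive_currified _ _ Ha1 Ha2).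
    transitivity (a0 * a0 - k * k); [ring | lra]. }
  apply (at_most_weaken (24 + 6) 30 _ (fun s =>
    (rectangle_system p r f D a0 b0 k C s /\ sol_be s <> 0) \/
    (rectangle_system p r f D a0 b0 k C s /\ sol_be s = 0))); [lia | intros; tauto |].
  apply at_most_or.
  + now apply rectangle_system_be_neq0.
  + now apply rectangle_system_be_eq0.
Qed.

(** * The incidence bound *)

Module Counting.
Import all_boot zify.
Set Implicit Arguments.
Unset Strict Implicit.
Local Open Scope nat_scope.

Lemma card_fiber_le (T I : finType) (A : {set T}) (f : T -> I) (K : nat) :
  (forall i, #|[set a in A | f a == i]| <= K) -> #|A| <= K * #|I|.
Proof.
move=> HK; rewrite -sum1_card (partition_big f predT) //= mulnC -sum_nat_const.
apply: leq_sum => i _; apply: leq_trans (HK i).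
rewrite -sum1_card; apply: eq_leq; apply: eq_bigl => a; by rewrite inE.
Qed.

(** Fix a representative in each fiber of [f] on [E]. Representatives inject into [I]; every other
    element collides with its representative. *)
Lemma card_le_image_collisions (T I : finType) (E : {set T}) (f : T -> I) :
  #|E| <= #|I| + #|[set p : T * T | [&& p.1 \in E, p.2 \in E, p.1 != p.2 & f p.1 == f p.2]]|.
Proof.
pose rep a := odflt a [pick b in E | f b == f a].
have repP a : a \in E -> (rep a \in E) && (f (rep a) == f a).
  by rewrite /rep => aE; case: pickP => [b //|/(_ a)] /=; rewrite aE eqxx.
have rep_eq a a' : a \in E -> a' \in E -> f a = f a' -> rep a = rep a'.
  move=> aE a'E eqf; rewrite /rep.
  rewrite (eq_pick (Q := fun b => (b \in E) && (f b == f a'))); last by move=> b; rewrite eqf.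
  by case: pickP => [//|/(_ a')]; rewrite a'E eqxx.
pose R := [set a in E | rep a == a].
rewrite -(cardsID R E); apply: leq_add.
  have f_inj : {in E :&: R &, injective f}.
    move=> a a'; rewrite !inE => /andP[_ /andP[aE /eqP<-]] /andP[_ /andP[a'E /eqP<-]] eqf.
    apply: rep_eq => //; have /andP[_ /eqP <-] := repP _ aE.
    by have /andP[_ /eqP <-] := repP _ a'E.
  by rewrite -(card_in_imset f_inj) max_card.
rewrite -(card_imset (f := fun a => (a, rep a))); last by move=> a a' [].
apply: subset_leq_card; apply/subsetP => _ /imsetP[a + ->]; rewrite !inE /=.
case/andP => + aE; rewrite aE /= eq_sym => ->.
by have /andP[-> /eqP->] := repP _ aE; rewrite eqxx.
Qed.

(** Cauchy-Schwarz for the fiber sizes [c w], by summing 2uv <= u^2 + v^2 over all pairs of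
    fibers. *)
Lemma card_equal_pairs (T I : finType) (z : T -> I) :
  #|T| * #|T| <= #|I| * #|[set p : T * T | z p.1 == z p.2]|.
Proof.
pose c w := #|[set a | z a == w]|.
have cT : #|T| = \sum_w c w.
  rewrite -sum1_card (partition_big z predT) //=; apply: eq_bigr => w _.
  by rewrite /c -sum1_card; apply: eq_bigl => a; rewrite inE.
have cE : #|[set p : T * T | z p.1 == z p.2]| = \sum_w c w * c w.
  rewrite -sum1_card (partition_big (fun p => z p.1) predT) //=; apply: eq_bigr => w _.
  rewrite /c -cardsX -sum1_card; apply: eq_bigl => -[a b]; rewrite !inE /=.
  by case: (z a =P w) => [->|]; rewrite ?andbF //= andbT eq_sym.
rewrite cT cE -(leq_pmul2l (m := 2)) // big_distrl /=.
under eq_bigr => i _ do rewrite big_distrr /=.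
rewrite big_distrr /=.
under eq_bigr => i _ do rewrite big_distrr /=.
apply: (@leq_trans (\sum_i \sum_j (c i * c i + c j * c j))).
  apply: leq_sum => i _; apply: leq_sum => j _.
  by rewrite !mulnn; case: (nat_Cauchy (c i) (c j)).
under eq_bigr => i _ do rewrite big_split /= sum_nat_const.
rewrite big_split /= sum_nat_const -big_distrr /=.
by rewrite addnn mul2n.
Qed.

(** * Incidences between a grid cut into cells and monotone curves *)

Section Energy.

(** [x], [y], [z] stand for the ranks of the distances to p1, p2, p3, and [s] for the sides of the
    two lines through p2. Cells have side [B], with [M] of them per axis, and [K] bounds the common
    curves of two grid points. *)
Variables (T : finType) (t : nat) (x y z : T -> 'I_t) (s : T -> bool * bool).
Variables (mono : bool * bool -> bool) (K B M : nat).

Hypothesis B_gt0 : 0 < B.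
Hypothesis t_le : t <= M * B.
Hypothesis xz_fiber : forall a, #|[set b | (z b == z a) && (x b == x a)]| <= 2.
Hypothesis xys_inj : forall a b, x a = x b -> y a = y b -> s a = s b -> a = b.
Hypothesis x_mono : forall a b, y a = y b -> s a = s b -> z a <= z b ->
  if mono (s a) then x a <= x b else x b <= x a.
Hypothesis two_points : forall u1 u2 v1 v2 (l : seq ('I_t * 'I_t)),
  u1 <> u2 -> v1 <> v2 -> (u1, u2) <> (v1, v2) -> uniq l ->
  (forall w, w \in l -> exists a1 a2 b1 b2,
     [/\ [/\ x a1 = u1, x a2 = u2, x b1 = v1 & x b2 = v2],
         [/\ y a1 = w.1, y a2 = w.2, y b1 = w.1 & y b2 = w.2],
         z a1 = z a2 & z b1 = z b2]) ->
  size l <= K.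

Let E := [set p : T * T | (z p.1 == z p.2) && (x p.1 != x p.2)].
Let cell (u : 'I_t) := u %/ B.

Let cell_lt u : cell u < M.
Proof. by rewrite ltn_divLR //; apply: leq_trans t_le. Qed.

Let cell_le (u v : 'I_t) : u <= v -> cell u <= cell v.
Proof. exact: leq_div2r. Qed.

(* Along a monotone chain of cells the (anti)diagonal index determines the cell. *)
Let diag (p : T * T) : 'I_(2 * M).+1 :=
  inord (if mono (s p.1) == mono (s p.2) then cell (x p.1) + cell (x p.2)
         else cell (x p.1) + (M - cell (x p.2))).

(** A curve, one of its 16 monotone branches, and a diagonal index locating the cell along that
    branch. *)
Let key (p : T * T) := (y p.1, y p.2, (s p.1, s p.2), diag p).

(** On a branch both cell coordinates are monotone in [z]. If they move the same way their sum
    determines them, otherwise their difference does. Coordinates are below [M], so the truncated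
    subtraction in [diag] is exact. *)
Let key_cell p q : p \in E -> q \in E -> key p = key q ->
  cell (x p.1) = cell (x q.1) /\ cell (x p.2) = cell (x q.2).
Proof.
wlog: p q / z p.1 <= z q.1 => [H|].
  case: (leqP (z p.1) (z q.1)) => [/H|/ltnW/H H' pE qE /esym] //.
  by case/(H' qE pE) => -> ->.
rewrite !inE => lez /andP[/eqP zp _] /andP[/eqP zq _] [y1 y2 s1 s2].
have lez2 : z p.2 <= z q.2 by rewrite -zp -zq.
move/(congr1 val); rewrite /diag -s1 -s2.
have := x_mono y1 s1 lez; have := x_mono y2 s2 lez2.
have lt_p1 := cell_lt (x p.1); have lt_p2 := cell_lt (x p.2).
have lt_q1 := cell_lt (x q.1); have lt_q2 := cell_lt (x q.2).
rewrite /= !inordK; try by case: ifP => _; lia.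
by case: (mono (s p.2)) => /cell_le c2; case: (mono (s p.1)) => /cell_le c1 /=; lia.
Qed.

Let collisions := [set p : (T * T) * (T * T) |
  [&& p.1 \in E, p.2 \in E, p.1 != p.2 & key p.1 == key p.2]].

(** A collision is two points of one cell on one branch. It is classified by the first grid point,
    the offset of the second in the cell, and the sectors. Within a class both grid points are fixed
    and the curve determines the collision, so [two_points] applies. *)
Let card_collisions : #|collisions| <= K * (t * t * (B * B) * 16).
Proof.
pose offset (u : 'I_t) : 'I_B := Ordinal (ltn_pmod u B_gt0).
pose g (p : (T * T) * (T * T)) := (x p.1.1, x p.1.2, (offset (x p.2.1), offset (x p.2.2)),
  (s p.1.1, s p.1.2)).
apply: leq_trans (card_fiber_le (f := g) (K := K) _) _; last first.
  by rewrite !card_prod !card_ord !card_bool.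
have offsetK u v : cell u = cell v -> offset u = offset v -> u = v.
  move=> eqc /(congr1 val) /= eqo; apply: val_inj.
  by rewrite /= (divn_eq u B) (divn_eq v B) eqo -/(cell u) eqc.
move=> i; set F := [set _ in _ | _].
have FP p : p \in F -> [/\ p.1 \in E, p.2 \in E, p.1 <> p.2, key p.1 = key p.2 & g p = i].
  by rewrite inE => /andP[+ /eqP->]; rewrite inE => /and4P[-> -> /eqP ? /eqP->].
have Fx p q : p \in F -> q \in F ->
    [/\ x p.1.1 = x q.1.1, x p.1.2 = x q.1.2, x p.2.1 = x q.2.1, x p.2.2 = x q.2.2 &
        s p.1.1 = s q.1.1 /\ s p.1.2 = s q.1.2].
  move=> /FP[p1E p2E _ kp gp] /FP[q1E q2E _ kq]; rewrite -gp => -[e1 e2 o1 o2 s1 s2].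
  have [cp1 cp2] := key_cell p1E p2E kp; have [cq1 cq2] := key_cell q1E q2E kq.
  split; [exact: esym | exact: esym | | | by split; exact: esym].
    by apply: offsetK; [rewrite -cp1 -cq1 e1 | apply: val_inj].
  by apply: offsetK; [rewrite -cp2 -cq2 e2 | apply: val_inj].
pose f (p : (T * T) * (T * T)) := (y p.1.1, y p.1.2).
have f_inj : {in F &, injective f}.
  move=> p q pF qF [y1 y2]; have [x1 x2 x1' x2' [s1 s2]] := Fx p q pF qF.
  have [_ _ _ [yp1 yp2 sp1 sp2 _] _] := FP _ pF.
  have [_ _ _ [yq1 yq2 sq1 sq2 _] _] := FP _ qF.
  case: p q {pF qF} x1 x2 x1' x2' y1 y2 s1 s2 yp1 yp2 sp1 sp2 yq1 yq2 sq1 sq2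
    => [[a1 a2] [b1 b2]] [[c1 c2] [d1 d2]] /= *.
  by congr (_, _, (_, _)); apply: xys_inj; congruence.
rewrite -(card_in_imset f_inj).
have [F0|[p0 p0F]] := set_0Vmem F; first by rewrite F0 imset0 cards0.
have [p1E p2E np kp _] := FP _ p0F.
rewrite cardE; apply: (two_points (u1 := x p0.1.1) (u2 := x p0.1.2)
  (v1 := x p0.2.1) (v2 := x p0.2.2)).
- by move: p1E; rewrite inE => /andP[_ /eqP].
- by move: p2E; rewrite inE => /andP[_ /eqP].
- case: p0 kp np {p0F p1E p2E} => [[a1 a2] [b1 b2]] /= [y1 y2 s1 s2 _] np [x1 x2].
  by apply: np; congr (_, _); exact: xys_inj.
- exact: enum_uniq.
- move=> w; rewrite mem_enum => /imsetP[p pF ->].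
  have [x1 x2 x1' x2' _] := Fx _ _ pF p0F.
  have [+ + _ [yp1 yp2 _ _ _] _] := FP _ pF.
  rewrite !inE => /andP[/eqP z1 _] /andP[/eqP z2 _].
  by exists p.1.1, p.1.2, p.2.1, p.2.2; rewrite /= -yp1 -yp2; split.
Qed.

(** Pairs with equal [z] either agree in [x], which leaves two partners per point, or lie in [E],
    whose size is at most the number of keys plus the collisions. *)
Lemma energy_bound :
  #|T| * #|T| <= t * (2 * #|T| + t * t * 16 * (2 * M).+1 + K * (t * t * (B * B) * 16)).
Proof.
apply: leq_trans (card_equal_pairs z) _; rewrite card_ord leq_mul2l; apply/orP; right.
pose D := [set p : T * T | (z p.2 == z p.1) && (x p.2 == x p.1)].
have -> : [set p : T * T | z p.1 == z p.2] = D :|: E.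
  by apply/setP => p; rewrite !inE ![_ p.2 == _]eq_sym; do 2!case: eqP.
apply: leq_trans (leq_card_setU _ _) _; rewrite -addnA; apply: leq_add.
  apply: (card_fiber_le (f := fst)) => a; apply: leq_trans (xz_fiber a).
  rewrite -(card_imset (f := pair a) [set b | (z b == z a) && (x b == x a)]);
    last by move=> b b' [].
  apply: subset_leq_card; apply/subsetP => -[a' b]; rewrite !inE /= => /andP[+ /eqP ea].
  by rewrite ea => Hb; apply/imsetP; exists b; rewrite ?inE.
apply: leq_trans (card_le_image_collisions E key) _; apply: leq_add.
  by rewrite !card_prod !card_ord !card_bool.
exact: card_collisions.
Qed.

End Energy.

Lemma In_mem (A : eqType) (a : A) (l : seq A) : List.In a l -> a \in l.
Proof. by elim: l => //= b l IH [->|/IH]; rewrite inE ?eqxx // orbC => ->. Qed.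

Lemma uniq_NoDup (A : eqType) (l : seq A) : uniq l -> List.NoDup l.
Proof.
elim: l => [|a l IH] /=; first by constructor.
by case/andP=> /negP al /IH; constructor => // /In_mem.
Qed.

(** Transfer to lists: the finite type consists of the positions in [P], and [inord] embeds the
    ranks below [t]. *)
Lemma energy_bound_list (A : Type) (P : list A) (t : nat) (x y z : A -> nat)
    (s : A -> bool * bool) (mono : bool * bool -> bool) (K B M : nat) :
  List.NoDup P -> (0 < B)%coq_nat -> (t <= M * B)%coq_nat ->
  (forall a, List.In a P -> (x a < t)%coq_nat /\ (y a < t)%coq_nat /\ (z a < t)%coq_nat) ->
  (forall a b c, List.In a P -> List.In b P -> List.In c P ->
     x a = x b -> x a = x c -> z a = z b -> z a = z c -> a = b \/ a = c \/ b = c) ->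
  (forall a b, List.In a P -> List.In b P -> x a = x b -> y a = y b -> s a = s b -> a = b) ->
  (forall a b, List.In a P -> List.In b P -> y a = y b -> s a = s b -> (z a <= z b)%coq_nat ->
     if mono (s a) then (x a <= x b)%coq_nat else (x b <= x a)%coq_nat) ->
  (forall u1 u2 v1 v2, u1 <> u2 -> v1 <> v2 -> (u1, u2) <> (v1, v2) ->
     at_most K (fun w : nat * nat => exists a1 a2 b1 b2,
       (List.In a1 P /\ List.In a2 P /\ List.In b1 P /\ List.In b2 P) /\
       (x a1 = u1 /\ x a2 = u2 /\ x b1 = v1 /\ x b2 = v2) /\
       (y a1 = fst w /\ y a2 = snd w /\ y b1 = fst w /\ y b2 = snd w) /\
       z a1 = z a2 /\ z b1 = z b2)) ->
  let n := List.length P in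
  (n * n <= t * (2 * n + t * t * 16 * (2 * M + 1)
     + K * (t * t * (B * B) * 16)))%coq_nat.
Proof.
move=> uP /ltP B_gt0 /leP t_le ltt xz_fiber xys_inj x_mono two_points n.
case eP: P => [|a0 P']; first by rewrite /n eP; apply/leP.
have a0P : List.In a0 P by rewrite eP; left.
case: t t_le ltt => [|t] t_le ltt.
  by have [/PeanoNat.Nat.nlt_0_r] := ltt a0 a0P.
pose pt (i : 'I_n) := List.nth i P a0.
have inP i : List.In (pt i) P by apply: List.nth_In; apply/ltP.
have pt_inj : injective pt.
  move=> i j eqp; apply: val_inj => /=.
  by apply: (proj1 (List.NoDup_nth P a0) uP) => //; apply/ltP.
have xK i : @inord t (x (pt i)) = x (pt i) :> nat.
  by rewrite inordK //; apply/ltP; have [] := ltt _ (inP i).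
have yK i : @inord t (y (pt i)) = y (pt i) :> nat.
  by rewrite inordK //; apply/ltP; have [_ []] := ltt _ (inP i).
have zK i : @inord t (z (pt i)) = z (pt i) :> nat.
  by rewrite inordK //; apply/ltP; have [_ [_]] := ltt _ (inP i).
have inord_val (h : A -> nat) i (u : 'I_t.+1) : (forall k, @inord t (h (pt k)) = h (pt k) :> nat) ->
    inord (h (pt i)) = u -> h (pt i) = u by move=> hK <-; rewrite hK.
rewrite addn1.
have {1 2 3}-> : n = #|'I_n| by rewrite card_ord.
apply/leP; apply: (@energy_bound 'I_n t.+1 (fun i => inord (x (pt i)))
  (fun i => inord (y (pt i))) (fun i => inord (z (pt i))) (fun i => s (pt i)) mono K B M) => //.
- move=> i; rewrite leqNgt; apply/negP => /card_gt2P [j [k [l [[+ + +] [njk nkl nlj]]]]].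
  rewrite !inE => /andP[/eqP zj /eqP xj] /andP[/eqP zk /eqP xk] /andP[/eqP zl /eqP xl].
  have := xz_fiber (pt j) (pt k) (pt l) (inP _) (inP _) (inP _).
  rewrite (inord_val _ _ _ xK xj) (inord_val _ _ _ xK xk) (inord_val _ _ _ xK xl) !xK.
  rewrite (inord_val _ _ _ zK zj) (inord_val _ _ _ zK zk) (inord_val _ _ _ zK zl) !zK.
  case/(_ erefl erefl erefl erefl) => [|[]] /pt_inj e.
  + by rewrite e eqxx in njk.
  + by rewrite e eqxx in nlj.
  + by rewrite e eqxx in nkl.
- by move=> i j /(congr1 val) + /(congr1 val); rewrite /= !xK !yK => ? ? ?;
    apply: pt_inj; apply: xys_inj.
- move=> i j /(congr1 val); rewrite /= !yK !zK !xK => yij sij /leP zij.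
  by have := x_mono _ _ (inP i) (inP j) yij sij zij; case: ifP => _ /leP.
- move=> u1 u2 v1 v2 l u12 v12 uv ul Hl.
  have val_neq (u v : 'I_t.+1) : u <> v -> (u : nat) <> v by move=> uv' /val_inj.
  rewrite -(size_map (fun w : 'I_t.+1 * 'I_t.+1 => (w.1 : nat, w.2 : nat))); apply/leP.
  apply: (two_points u1 u2 v1 v2); [exact: val_neq | exact: val_neq | | |].
  + by case=> /val_inj e1 /val_inj e2; apply: uv; rewrite e1 e2.
  + apply: uniq_NoDup; rewrite map_inj_uniq // => -[w1 w2] [w1' w2'] /= [].
    by move=> /val_inj -> /val_inj ->.
  + move=> w /In_mem /mapP[w' /Hl [a1 [a2 [b1 [b2 [[xa1 xa2 xb1 xb2] [ya1 ya2 yb1 yb2] za zb]]]]] ->].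
    exists (pt a1), (pt a2), (pt b1), (pt b2).
    split; first by do !split; apply: inP.
    rewrite (inord_val _ _ _ xK xa1) (inord_val _ _ _ xK xa2) (inord_val _ _ _ xK xb1).
    rewrite (inord_val _ _ _ xK xb2) (inord_val _ _ _ yK ya1) (inord_val _ _ _ yK ya2).
    rewrite (inord_val _ _ _ yK yb1) (inord_val _ _ _ yK yb2).
    by rewrite (inord_val _ _ _ zK za) (inord_val _ _ _ zK zb) !zK.
Qed.

End Counting.

(** * Application to distances *)

(** Order-preserving passage from real distances to the integer coordinates of the grid. *)
Definition rank (V : list R) (v : R) : nat :=
  length (filter (fun w => if Rlt_dec w v then true else false) V).

Lemma rank_le V v w : v <= w -> (rank V v <= rank V w)%nat.
Proof.
intros Hvw; unfold rank; induction V as [|a V IH]; simpl; [lia |].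
destruct (Rlt_dec a v), (Rlt_dec a w); simpl; try lia; lra.
Qed.

Lemma rank_lt V v w : v < w -> In v V -> (rank V v < rank V w)%nat.
Proof.
intros Hvw; induction V as [|a V IH]; [easy |].
assert (Hle := rank_le V v w (Rlt_le _ _ Hvw)).
unfold rank in *; simpl; intros [<-|Hv].
- destruct (Rlt_dec a a), (Rlt_dec a w); simpl; try lra; lia.
- specialize (IH Hv).
  destruct (Rlt_dec a v), (Rlt_dec a w); simpl; try lia; lra.
Qed.

Lemma rank_lt_length V v : In v V -> (rank V v < length V)%nat.
Proof.
unfold rank; induction V as [|a V IH]; [easy |].
assert (Hle := filter_length_le (fun w => if Rlt_dec w v then true else false) V).
simpl; intros [->|Hv].
- destruct (Rlt_dec v v); [lra | lia].
- specialize (IH Hv); destruct (Rlt_dec a v); simpl; lia.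
Qed.

Lemma rank_le_inv V v w : In w V -> (rank V v <= rank V w)%nat -> v <= w.
Proof.
intros Hw H; destruct (Rle_or_lt v w) as [|Hlt]; [assumption |].
assert (H' := rank_lt V w v Hlt Hw); lia.
Qed.

Lemma rank_inj V v w : In v V -> In w V -> rank V v = rank V w -> v = w.
Proof.
intros Hv Hw E; apply Rle_antisym; apply (rank_le_inv V); auto; lia.
Qed.

Definition nonneg (v : R) : bool := if Rle_dec 0 v then true else false.

Lemma nonneg_eq_sqr v w : v * v = w * w -> nonneg v = nonneg w -> v = w.
Proof.
unfold nonneg; intros E.
destruct (Rle_dec 0 v), (Rle_dec 0 w); try discriminate; intros _; nra.
Qed.

(* With d = a - b and s = a + b one has d orthogonal to s, so that the linear forms
   <u, d> and d1 have a ratio whose sign is read off det(u, s) and s2. *)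
Lemma circle_sector_monotone u1 u2 a1 a2 b1 b2 :
  u2 <> 0 -> a1 * a1 + a2 * a2 = b1 * b1 + b2 * b2 -> a1 <= b1 ->
  nonneg a2 = nonneg b2 ->
  nonneg (u1 * a2 - u2 * a1) = nonneg (u1 * b2 - u2 * b1) ->
  if Bool.eqb (nonneg (u1 * a2 - u2 * a1)) (nonneg a2)
  then u1 * a1 + u2 * a2 <= u1 * b1 + u2 * b2
  else u1 * b1 + u2 * b2 <= u1 * a1 + u2 * a2.
Proof.
intros Hu2 Eab [Hlt|E1] E2 Ed.
2: { subst b1.
  assert (Eb2 : a2 = b2) by (apply nonneg_eq_sqr; [lra | assumption]).
  subst b2; destruct (Bool.eqb _ _); lra. }
assert (E0 : (u1 * a1 + u2 * a2 - (u1 * b1 + u2 * b2)) * (a2 + b2)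
  = (a1 - b1) * ((u1 * a2 - u2 * a1) + (u1 * b2 - u2 * b1))).
{ transitivity ((a1 - b1) * ((u1 * a2 - u2 * a1) + (u1 * b2 - u2 * b1))
    + u2 * (a1 * a1 + a2 * a2 - (b1 * b1 + b2 * b2))); [ring |].
  rewrite Eab; ring. }
set (da := u1 * a2 - u2 * a1) in *; set (db := u1 * b2 - u2 * b1) in *.
set (d := u1 * a1 + u2 * a2 - (u1 * b1 + u2 * b2)) in *.
(* Otherwise equal signs force [a2 = b2 = 0], so [a1 = - b1], and [da], [db] are nonzero of opposite
   signs. *)
assert (Hd : a2 + b2 <> 0).
{ intros Es.
  assert (Ha2 : a2 = 0 /\ b2 = 0).
  { unfold nonneg in E2.
    destruct (Rle_dec 0 a2), (Rle_dec 0 b2); try discriminate; lra. }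
  destruct Ha2; subst a2 b2.
  assert (E1 : a1 = - b1) by nra.
  assert (H1 : u2 * b1 <> 0) by (apply Rmult_integral_contrapositive_currified; lra).
  unfold nonneg, da, db in Ed; subst a1.
  destruct (Rle_dec _ _) in Ed; destruct (Rle_dec _ _) in Ed; try discriminate; lra. }
unfold nonneg in *.
destruct (Rle_dec 0 a2), (Rle_dec 0 b2); try discriminate;
  destruct (Rle_dec 0 da), (Rle_dec 0 db); try discriminate; simpl.
- assert (0 < a2 + b2) by lra.
  assert (d * (a2 + b2) <= 0) by (rewrite E0; nra).
  assert (d <= 0) by nra; unfold d in *; lra.
- assert (0 < a2 + b2) by lra.
  assert (0 <= d * (a2 + b2)) by (rewrite E0; nra).
  assert (0 <= d) by nra; unfold d in *; lra.
- assert (a2 + b2 < 0) by lra.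
  assert (d * (a2 + b2) <= 0) by (rewrite E0; nra).
  assert (0 <= d) by nra; unfold d in *; lra.
- assert (a2 + b2 < 0) by lra.
  assert (0 <= d * (a2 + b2)) by (rewrite E0; nra).
  assert (d <= 0) by nra; unfold d in *; lra.
Qed.

(* Coordinates with p3 = (0, 0), p2 = (D, 0), p1 = (e, f); [e_neq0] and [not_right] say
   that the angles at p3 and p1 are not right. *)
Section Normalized.

Variables D e f : R.
Hypothesis D_pos : 0 < D.
Hypothesis e_neq0 : e <> 0.
Hypothesis f_neq0 : f <> 0.
Hypothesis not_right : f * f <> e * (D - e).

Definition sqd1 (q : R * R) : R := (fst q - e) * (fst q - e) + (snd q - f) * (snd q - f).
Definition sqd2 (q : R * R) : R := (fst q - D) * (fst q - D) + snd q * snd q.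
Definition sqd3 (q : R * R) : R := fst q * fst q + snd q * snd q.

(** Sides of the lines p2p1 and p2p3. The first entry is the sign of det(u, q - p2) with u = p2 - p1
    = [(D - e, - f)]. *)
Definition sector (q : R * R) : bool * bool :=
  (nonneg ((D - e) * snd q - - f * (fst q - D)), nonneg (snd q)).

(** Two circles with distinct centres: subtracting their equations gives a line, and the first
    coordinate on it solves a quadratic. *)
Lemma sqd13_fiber a b c :
  sqd1 a = sqd1 b -> sqd1 a = sqd1 c -> sqd3 a = sqd3 b -> sqd3 a = sqd3 c ->
  a = b \/ a = c \/ b = c.
Proof.
destruct a as [ag ah], b as [bg bh], c as [cg ch]; unfold sqd1, sqd3; simpl.
intros X1 X2 Z1 Z2.
assert (L1 : f * bh = e * ag + f * ah - e * bg) by lra.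
assert (L2 : f * ch = e * ag + f * ah - e * cg) by lra.
assert (Q : forall g h, f * h = e * ag + f * ah - e * g -> ag * ag + ah * ah = g * g + h * h ->
  (ag - g) * ((f * f + e * e) * (ag + g) - 2 * e * (e * ag + f * ah)) = 0).
{ intros g h L Z.
  transitivity (f * f * (ag * ag + ah * ah) - (f * f * (g * g)
    + (e * ag + f * ah - e * g) * (e * ag + f * ah - e * g))); [ring |].
  rewrite <- L, Z; ring. }
assert (Heq : forall g g' h h', f * h = e * ag + f * ah - e * g ->
  f * h' = e * ag + f * ah - e * g' -> g = g' -> (g, h) = (g', h')).
{ intros g g' h h' Lh Lh' <-; f_equal; apply (Rmult_eq_reg_l f); [congruence | assumption]. }
assert (L0 : f * ah = e * ag + f * ah - e * ag) by lra.
destruct (Rmult_integral _ _ (Q bg bh L1 Z1)) as [H1|H1]; [left; apply Heq; lra |].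
destruct (Rmult_integral _ _ (Q cg ch L2 Z2)) as [H2|H2]; [right; left; apply Heq; lra |].
right; right; apply Heq; [lra | lra |].
assert (0 < f * f) by nra.
apply (Rmult_eq_reg_l (f * f + e * e)); nra.
Qed.

(** Circles around p1 and p2 meet in points symmetric about p1p2, which the sign of the determinant
    tells apart. *)
Lemma sqd12_sector_inj a b :
  sqd1 a = sqd1 b -> sqd2 a = sqd2 b -> sector a = sector b -> a = b.
Proof.
destruct a as [ag ah], b as [bg bh]; unfold sqd1, sqd2, sector; simpl.
intros X Y S; injection S as S _.
assert (L : (D - e) * (ag - D) + - f * ah = (D - e) * (bg - D) + - f * bh) by lra.
assert (Ed : (D - e) * ah - - f * (ag - D) = (D - e) * bh - - f * (bg - D)).
{ apply nonneg_eq_sqr; [| assumption].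
  transitivity (((D - e) * (D - e) + f * f) * ((ag - D) * (ag - D) + ah * ah)
    - ((D - e) * (ag - D) + - f * ah) * ((D - e) * (ag - D) + - f * ah)); [ring |].
  rewrite L, Y; ring. }
assert (0 < (D - e) * (D - e) + f * f) by nra.
f_equal; apply (Rmult_eq_reg_l ((D - e) * (D - e) + f * f)); try lra.
- transitivity ((D - e) * ((D - e) * (ag - D) + - f * ah)
    + f * ((D - e) * ah - - f * (ag - D)) + ((D - e) * (D - e) + f * f) * D); [ring |].
  rewrite L, Ed; ring.
- transitivity (- f * ((D - e) * (ag - D) + - f * ah)
    + (D - e) * ((D - e) * ah - - f * (ag - D))); [ring |].
  rewrite L, Ed; ring.
Qed.

(** On a circle around p2, [sqd3] and [sqd1] are increasing affine functions of the first coordinate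
    and of the scalar product of p2 - p1 with q - p2. *)
Lemma sector_monotone a b :
  sqd2 a = sqd2 b -> sector a = sector b -> sqd3 a <= sqd3 b ->
  if Bool.eqb (fst (sector a)) (snd (sector a))
  then sqd1 a <= sqd1 b else sqd1 b <= sqd1 a.
Proof.
destruct a as [ag ah], b as [bg bh]; unfold sqd1, sqd2, sqd3, sector; simpl.
intros Y S Z; injection S as S1 S2.
assert (Hg : ag - D <= bg - D) by nra.
assert (Hf : - f <> 0) by lra.
generalize (circle_sector_monotone (D - e) (- f) (ag - D) ah (bg - D) bh Hf Y Hg S2 S1).
destruct (Bool.eqb _ _); lra.
Qed.

(** Inverts the parametrization of [rectangle_system], with signs (i, j) = (1, 1), (-1, 1), (1, -1),
    (-1, -1) for [a1], [a2], [b1], [b2]. In [quad_recover], [sg] is i and j is 1. *)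
Definition quad_solution (a1 a2 b1 b2 : R * R) : R * R * R * R :=
  ((fst a1 - fst a2) / 2, (fst a1 - fst b1) / 2, (fst a1 + fst b2) / 2,
   (snd a1 + snd a2 + snd b1 + snd b2) / 4).

Definition quad_recover (x1 x2 x1' x2' sg : R) (s : R * R * R * R) : R * R :=
  let '(al, be, m, H) := s in
  (m + sg * al + be, H + sg * (- (x1 - x2 + x1' - x2') / (8 * f) - e / f * al)
     + (- (x1 - x1' + x2 - x2') / (8 * f) + (D - e) / f * be)
     + sg * (- (x1 - x2 - x1' + x2') / (8 * f))).

(** When [sqd3] agrees, a difference of [sqd1] is linear in the coordinate differences; likewise for
    [sqd2]. Hence [Ea], [Eb], [Ek]. *)
Lemma quad_system a1 a2 b1 b2 :
  sqd3 a1 = sqd3 a2 -> sqd3 b1 = sqd3 b2 -> sqd2 a1 = sqd2 b1 -> sqd2 a2 = sqd2 b2 ->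
  let x1 := sqd1 a1 in let x2 := sqd1 a2 in let x1' := sqd1 b1 in let x2' := sqd1 b2 in
  rectangle_system (e / f) ((D - e) / f) f D
    (- (x1 - x2 + x1' - x2') / (8 * f)) (- (x1 - x1' + x2 - x2') / (8 * f))
    (- (x1 - x2 - x1' + x2') / (8 * f))
    ((x1 + x2 + x1' + x2') / 4 - e * e - f * f) (quad_solution a1 a2 b1 b2) /\
  a1 = quad_recover x1 x2 x1' x2' 1 (quad_solution a1 a2 b1 b2) /\
  a2 = quad_recover x1 x2 x1' x2' (-1) (quad_solution a1 a2 b1 b2).
Proof.
destruct a1 as [g1 h1], a2 as [g2 h2], b1 as [g3 h3], b2 as [g4 h4].
intros Z1 Z2 Y1 Y2 x1 x2 x1' x2'.
unfold sqd1, sqd2, sqd3, quad_solution, quad_recover, rectangle_system in *; simpl in *.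
(* [sqd3 - sqd2] is affine in the first coordinate with slope [2 * D], and its alternating sum over
   the four points vanishes. *)
assert (Eg : g4 = g2 + g3 - g1).
{ apply (Rmult_eq_reg_l D); [| lra]; lra. }
subst g4.
assert (Ea : - (x1 - x2 + x1' - x2') / (8 * f) - e / f * ((g1 - g2) / 2)
  = (h1 - h2 + h3 - h4) / 4).
{ apply (Rmult_eq_reg_l (8 * f)); [| lra].
  transitivity (- (x1 - x2 + x1' - x2') - 4 * e * (g1 - g2)); [field; assumption |].
  unfold x1, x2, x1', x2'; lra. }
assert (Eb : - (x1 - x1' + x2 - x2') / (8 * f) + (D - e) / f * ((g1 - g3) / 2)
  = (h1 - h3 + h2 - h4) / 4).
{ apply (Rmult_eq_reg_l (8 * f)); [| lra].
  transitivity (- (x1 - x1' + x2 - x2') + 4 * (D - e) * (g1 - g3)); [field; assumption |].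
  unfold x1, x2, x1', x2'; lra. }
assert (Ek : - (x1 - x2 - x1' + x2') / (8 * f) = (h1 - h2 - h3 + h4) / 4).
{ apply (Rmult_eq_reg_l (8 * f)); [| lra].
  transitivity (- (x1 - x2 - x1' + x2')); [field; assumption |].
  unfold x1, x2, x1', x2'; lra. }
rewrite Ea, Eb, Ek.
replace (e / f * f) with e by (field; assumption).
unfold x1, x2, x1', x2'.
repeat split; try lra; f_equal; lra.
Qed.

(** Ranks are injective on [V], so one realized label fixes the four values of [sqd1]. All labels
    then yield solutions of a single rectangle system, from which they are recovered. *)
Lemma rank_quads_finite (P : list (R * R)) (V : list R) u1 u2 v1 v2 :
  (forall q, In q P -> In (sqd1 q) V /\ In (sqd2 q) V /\ In (sqd3 q) V) ->
  u1 <> u2 -> v1 <> v2 -> (u1, u2) <> (v1, v2) ->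
  let x q := rank V (sqd1 q) in
  let y q := rank V (sqd2 q) in
  let z q := rank V (sqd3 q) in
  at_most 30 (fun w : nat * nat => exists a1 a2 b1 b2,
    (In a1 P /\ In a2 P /\ In b1 P /\ In b2 P) /\
    (x a1 = u1 /\ x a2 = u2 /\ x b1 = v1 /\ x b2 = v2) /\
    (y a1 = fst w /\ y a2 = snd w /\ y b1 = fst w /\ y b2 = snd w) /\
    z a1 = z a2 /\ z b1 = z b2).
Proof.
intros HV Hu Hv Huv x y z.
set (S := fun w : nat * nat => _).
destruct (classic (exists w, S w)) as [[w0 Hw0]|Hno].
2: { intros [|w l] _ Hin; [simpl; lia |].
  destruct Hno; exists w; apply Hin; simpl; auto. }
destruct Hw0 as [c1 [c2 [d1 [d2 [[Pc1 [Pc2 [Pd1 Pd2]]] [[Xc1 [Xc2 [Xd1 Xd2]]] _]]]]]].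
set (x1 := sqd1 c1); set (x2 := sqd1 c2); set (x1' := sqd1 d1); set (x2' := sqd1 d2).
assert (N12 : x1 <> x2) by (intros E; apply Hu; rewrite <- Xc1, <- Xc2; exact (f_equal (rank V) E)).
assert (N12' : x1' <> x2') by (intros E; apply Hv; rewrite <- Xd1, <- Xd2; exact (f_equal (rank V) E)).
assert (N : x1 <> x1' \/ x2 <> x2').
{ destruct (Req_dec x1 x1') as [E1|]; [right | now left].
  intros E2; apply Huv; rewrite <- Xc1, <- Xc2, <- Xd1, <- Xd2.
  exact (f_equal2 pair (f_equal (rank V) E1) (f_equal (rank V) E2)). }
assert (HX : forall q q', In q P -> In q' P -> x q = x q' -> sqd1 q = sqd1 q')
  by (intros q q' Hq Hq'; apply rank_inj; now apply HV).
assert (HY : forall q q', In q P -> In q' P -> y q = y q' -> sqd2 q = sqd2 q')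
  by (intros q q' Hq Hq'; apply rank_inj; now apply HV).
assert (HZ : forall q q', In q P -> In q' P -> z q = z q' -> sqd3 q = sqd3 q')
  by (intros q q' Hq Hq'; apply rank_inj; now apply HV).
apply (at_most_relation 30 S
  (rectangle_system (e / f) ((D - e) / f) f D
    (- (x1 - x2 + x1' - x2') / (8 * f)) (- (x1 - x1' + x2 - x2') / (8 * f))
    (- (x1 - x2 - x1' + x2') / (8 * f))
    ((x1 + x2 + x1' + x2') / 4 - e * e - f * f))
  (fun w s => w = (y (quad_recover x1 x2 x1' x2' 1 s), y (quad_recover x1 x2 x1' x2' (-1) s)))).
- intros [w1 w2] [a1 [a2 [b1 [b2 [[Pa1 [Pa2 [Pb1 Pb2]]] [[Xa1 [Xa2 [Xb1 Xb2]]]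
    [[Ya1 [Ya2 [Yb1 Yb2]]] [Za Zb]]]]]]]].
  cbn [fst snd] in Ya1, Ya2, Yb1, Yb2.
  assert (Y1 : y a1 = y b1) by congruence.
  assert (Y2 : y a2 = y b2) by congruence.
  generalize (quad_system a1 a2 b1 b2 (HZ _ _ Pa1 Pa2 Za) (HZ _ _ Pb1 Pb2 Zb)
    (HY a1 b1 Pa1 Pb1 Y1) (HY a2 b2 Pa2 Pb2 Y2)).
  rewrite (HX a1 c1), (HX a2 c2), (HX b1 d1), (HX b2 d2) by (assumption || congruence).
  fold x1 x2 x1' x2'; intros [Hs [E1 E2]].
  exists (quad_solution a1 a2 b1 b2); split; [| exact Hs].
  now rewrite <- E1, <- E2, Ya1, Ya2.
- intros w w' s -> ->; reflexivity.
- assert (Hdiv : forall v, v <> 0 -> v / (4 * f) <> 0).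
  { intros v Hnv E; apply Hnv; transitivity (v / (4 * f) * (4 * f)); [field; assumption |].
    rewrite E; ring. }
  apply rectangle_system_finite.
  (* [p <> 0] and [p * r <> 1] express that the angles at p3 and at p1 are not right; the remaining
     conditions come from the inequalities between the [sqd1] values. *)
  + intros E; apply e_neq0; transitivity (e / f * f); [field; assumption |].
    rewrite E; ring.
  + intros E; apply not_right.
    transitivity (e / f * ((D - e) / f) * (f * f)); [rewrite E; ring | field; assumption].
  + replace (_ + _) with ((x2 - x1) / (4 * f)) by (field; assumption); apply Hdiv; lra.
  + replace (_ - _) with ((x2' - x1') / (4 * f)) by (field; assumption); apply Hdiv; lra.
  + destruct N as [N|N]; [left | right].
    * replace (_ + _) with ((x1' - x1) / (4 * f)) by (field; assumption); apply Hdiv; lra.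
    * replace (_ - _) with ((x2' - x2) / (4 * f)) by (field; assumption); apply Hdiv; lra.
Qed.

Lemma normalized_count (P : list (R * R)) (V : list R) (B M : nat) :
  NoDup P -> (0 < B)%nat -> (length V <= M * B)%nat ->
  (forall q, In q P -> In (sqd1 q) V /\ In (sqd2 q) V /\ In (sqd3 q) V) ->
  let n := length P in let t := length V in
  (n * n <= t * (2 * n + t * t * 16 * (2 * M + 1) + 30 * (t * t * (B * B) * 16)))%nat.
Proof.
intros HP HB HM HV.
apply (@Counting.energy_bound_list _ P (length V) (fun q => rank V (sqd1 q))
  (fun q => rank V (sqd2 q)) (fun q => rank V (sqd3 q)) sector
  (fun s => Bool.eqb (fst s) (snd s)) 30 B M); try assumption.
- intros q Hq; destruct (HV q Hq) as [H1 [H2 H3]].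
  repeat split; now apply rank_lt_length.
- intros a b c Ha Hb Hc E1 E2 E3 E4.
  apply sqd13_fiber; apply (rank_inj V); auto; now apply HV.
- intros a b Ha Hb E1 E2 E3.
  apply sqd12_sector_inj; auto; apply (rank_inj V); auto; now apply HV.
- intros a b Ha Hb E2 Es Hle.
  assert (Hm : sqd2 a = sqd2 b) by (apply (rank_inj V); auto; now apply HV).
  apply rank_le_inv in Hle; [| now apply HV].
  generalize (sector_monotone a b Hm Es Hle).
  destruct (Bool.eqb _ _); apply rank_le.
- intros u1 u2 v1 v2; apply rank_quads_finite; assumption.
Qed.

End Normalized.

(** * Reduction of a triangle to normalized coordinates *)

Definition dot (u v : point) : R := fst u * fst v + snd u * snd v.
Definition vec (p q : point) : point := (fst q - fst p, snd q - snd p).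
Definition cross (u v : point) : R := fst u * snd v - snd u * fst v.

Lemma dist_sqr p q : dist p q * dist p q = dot (vec p q) (vec p q).
Proof. 
unfold dist, dot, vec; rewrite sqrt_sqrt; [simpl; ring |].
apply Rplus_le_le_0_compat; apply pow2_ge_0.
Qed.

Lemma triangle_count (p1 p2 p3 : point) (P : list point) (V : list R) (B M : nat) :
  ~ collinear p1 p2 p3 ->
  dot (vec p1 p2) (vec p1 p3) <> 0 -> dot (vec p3 p1) (vec p3 p2) <> 0 ->
  NoDup P -> NoDup V -> (forall v, In v V -> 0 <= v) ->
  (0 < B)%nat -> (length V <= M * B)%nat ->
  (forall q, In q P -> In (dist p1 q) V /\ In (dist p2 q) V /\ In (dist p3 q) V) ->
  let n := length P in let t := length V in
  (n * n <= t * (2 * n + t * t * 16 * (2 * M + 1) + 30 * (t * t * (B * B) * 16)))%nat.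
Proof.
intros Hcol H1 H3 HP HV HV0 HB HM Hin.
(* A similarity of ratio |p2 p3|, which avoids dividing by that length. *)
set (w := vec p3 p2).
set (N := dot w w).
set (phi := fun q => (dot w (vec p3 q), cross w (vec p3 q))).
set (scale := fun d : R => N * (d * d)).
assert (Hcross : cross w (vec p3 p1) <> 0).
{ intros E; apply Hcol; unfold collinear; unfold cross, w, vec in E; simpl in E; lra. }
assert (HN : 0 < N).
{ unfold N, dot; destruct (Req_dec (fst w) 0), (Req_dec (snd w) 0); try nra.
  destruct Hcross; unfold cross; nra. }
assert (Hphi : forall q q', phi q = phi q' -> q = q').
{ intros [g h] [g' h'] E; injection E as E1 E2.
  set (a := fst w) in *; set (b := snd w) in *.
  change (a * (g - fst p3) + b * (h - snd p3) = a * (g' - fst p3) + b * (h' - snd p3)) in E1.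
  change (a * (h - snd p3) - b * (g - fst p3) = a * (h' - snd p3) - b * (g' - fst p3)) in E2.
  assert (EN : N = a * a + b * b) by reflexivity.
  f_equal; apply (Rmult_eq_reg_l N); try lra; rewrite EN.
  - transitivity (a * (a * (g - fst p3) + b * (h - snd p3))
      - b * (a * (h - snd p3) - b * (g - fst p3)) + (a * a + b * b) * fst p3); [ring |].
    rewrite E1, E2; ring.
  - transitivity (b * (a * (g - fst p3) + b * (h - snd p3))
      + a * (a * (h - snd p3) - b * (g - fst p3)) + (a * a + b * b) * snd p3); [ring |].
    rewrite E1, E2; ring. }
assert (Hscale : forall v v', In v V -> In v' V -> scale v = scale v' -> v = v').
{ intros v v' Hv Hv' E; apply HV0 in Hv; apply HV0 in Hv'; unfold scale in E.
  assert (v * v = v' * v') by (apply (Rmult_eq_reg_l N); lra).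
  nra. }
generalize (normalized_count N (dot w (vec p3 p1)) (cross w (vec p3 p1)) HN).
rewrite <- (length_map phi P), <- (length_map scale V).
intros Hcount; apply Hcount; try assumption; clear Hcount.
- unfold w, dot in *; lra.
(* In the new coordinates [f * f - e * (D - e)] is [N] times the scalar product at p1. *)
- intros E; destruct (Rmult_integral_contrapositive_currified N (dot (vec p1 p2) (vec p1 p3)));
    [lra | assumption |].
  transitivity (cross w (vec p3 p1) * cross w (vec p3 p1)
    - dot w (vec p3 p1) * (N - dot w (vec p3 p1))); [| rewrite E; ring].
  unfold N, w, dot, cross, vec; simpl; ring.
- apply NoDup_map_NoDup_ForallPairs; [| assumption].
  intros q q' _ _; apply Hphi.
- now rewrite length_map.
- intros q' Hq'; apply in_map_iff in Hq'; destruct Hq' as [q [<- Hq]].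
  destruct (Hin q Hq) as [I1 [I2 I3]].
  assert (E : forall p, scale (dist p q) = N * dot (vec p q) (vec p q)).
  { intros p; unfold scale; now rewrite dist_sqr. }
  repeat split.
  + replace (sqd1 _ _ _) with (scale (dist p1 q)); [now apply in_map |].
    rewrite E; unfold sqd1, phi, N, w, dot, cross, vec; simpl; ring.
  + replace (sqd2 _ _) with (scale (dist p2 q)); [now apply in_map |].
    rewrite E; unfold sqd2, phi, N, w, dot, cross, vec; simpl; ring.
  + replace (sqd3 _) with (scale (dist p3 q)); [now apply in_map |].
    rewrite E; unfold sqd3, phi, N, w, dot, cross, vec; simpl; ring.
Qed.

(** A right angle, of which there is at most one, is moved to the role of p2. *)
Lemma distances_count (p1 p2 p3 : point) (P : list point) (V : list R) (B M : nat) :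
  ~ collinear p1 p2 p3 ->
  NoDup P -> NoDup V -> (forall v, In v V -> 0 <= v) ->
  (0 < B)%nat -> (length V <= M * B)%nat ->
  (forall q, In q P -> In (dist p1 q) V /\ In (dist p2 q) V /\ In (dist p3 q) V) ->
  let n := length P in let t := length V in
  (n * n <= t * (2 * n + t * t * 16 * (2 * M + 1) + 30 * (t * t * (B * B) * 16)))%nat.
Proof.
intros Hcol HP HV HV0 HB HM Hin.
assert (Hright : forall a b c : point, ~ collinear a b c ->
  dot (vec a b) (vec a c) = 0 -> dot (vec b c) (vec b a) <> 0).
{ intros a b c Habc E1 E2; apply Habc.
  unfold collinear, dot, vec in *; simpl in *.
  set (u := fst b - fst a) in *; set (v := snd b - snd a) in *.
  assert (Euv : u * u + v * v = 0) by (unfold u, v in *; lra).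
  assert (Hu : u = 0) by nra.
  assert (Hv : v = 0) by nra.
  rewrite Hu, Hv; ring. }
assert (Hdot : forall u v, dot u v = dot v u) by (intros; unfold dot; ring).
assert (H213 : ~ collinear p2 p1 p3) by (unfold collinear in *; lra).
assert (H132 : ~ collinear p1 p3 p2) by (unfold collinear in *; lra).
assert (H321 : ~ collinear p3 p2 p1) by (unfold collinear in *; lra).
destruct (Req_dec (dot (vec p1 p2) (vec p1 p3)) 0) as [E1|E1];
  [| destruct (Req_dec (dot (vec p3 p1) (vec p3 p2)) 0) as [E3|E3]].
- apply (triangle_count p2 p1 p3); try assumption.
  + rewrite Hdot; now apply Hright.
  + apply Hright; [assumption | now rewrite Hdot].
  + intros q Hq; destruct (Hin q Hq) as [? [? ?]]; auto.
- apply (triangle_count p1 p3 p2); try assumption.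
  + now rewrite Hdot.
  + apply Hright; [assumption | now rewrite Hdot].
  + intros q Hq; destruct (Hin q Hq) as [? [? ?]]; auto.
- now apply (triangle_count p1 p2 p3).
Qed.

(** * Cell size and the exponent 6/11 *)

Lemma cube_root_nat (t : nat) :
  (1 <= t)%nat -> exists B, (1 <= B /\ B * B * B <= t /\ t <= (8 * (B * B)) * B)%nat.
Proof.
intros Ht.
assert (H : exists B, (1 <= B /\ B * B * B <= t /\ t < (B + 1) * (B + 1) * (B + 1))%nat).
{ induction Ht as [|t Ht [B [H1 [H2 H3]]]]; [exists 1%nat; lia |].
  destruct (Nat.lt_ge_cases (S t) ((B + 1) * (B + 1) * (B + 1))) as [H|H].
  - exists B; lia.
  - exists (B + 1)%nat; nia. }
destruct H as [B [H1 [H2 H3]]]; exists B; nia.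
Qed.

(** If n <= 4t the bound is immediate. Otherwise 2nt <= n^2/2, so n^2 <= 1504 t^3 B^2; cubing and
    using B^3 <= t gives n^6 <= (1504 t)^11. *)
Lemma real_exponent_bound (n t B : R) :
  1 <= n -> 1 <= t -> 1 <= B -> B * B * B <= t ->
  n * n <= t * (2 * n + 752 * (t * t * (B * B))) ->
  / 1504 * Rpower n (6 / 11) <= t.
Proof.
intros Hn Ht HB HBt H.
apply (Rmult_le_reg_l 1504); [lra |].
rewrite <- Rmult_assoc, Rinv_r, Rmult_1_l by lra.
destruct (Rle_or_lt n (4 * t)) as [Hnt|Hnt].
- apply Rle_trans with (Rpower n 1); [| rewrite Rpower_1; lra].
  apply Rle_Rpower; lra.
- assert (H0 : n ^ 2 <= 1504 * t ^ 3 * B ^ 2) by nra.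
  assert (H6 : n ^ 6 <= (1504 * t) ^ 11).
  { replace (n ^ 6) with ((n ^ 2) ^ 3) by ring.
    apply Rle_trans with ((1504 * t ^ 3 * B ^ 2) ^ 3).
    - apply pow_incr; split; [apply pow2_ge_0 | assumption].
    - replace ((1504 * t ^ 3 * B ^ 2) ^ 3) with (1504 ^ 3 * t ^ 9 * (B * B * B) ^ 2) by ring.
      replace ((1504 * t) ^ 11) with (1504 ^ 11 * t ^ 9 * t ^ 2) by ring.
      assert (0 < B * B * B) by (repeat apply Rmult_lt_0_compat; lra).
      assert (0 < t ^ 9) by (apply pow_lt; lra).
      apply Rmult_le_compat.
      + apply Rmult_le_pos; [apply pow_le |]; lra.
      + apply pow2_ge_0.
      + apply Rmult_le_compat_r; [lra |].
        apply Rle_pow; [lra | lia].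
      + apply pow_incr; lra. }
  replace (6 / 11) with (INR 6 * / 11) by (simpl; field).
  rewrite <- Rpower_mult, Rpower_pow by lra.
  apply Rle_trans with (Rpower ((1504 * t) ^ 11) (/ 11)).
  + apply Rle_Rpower_l; [lra | split; [apply pow_lt; lra | assumption]].
  + rewrite <- Rpower_pow, Rpower_mult by lra.
    replace (INR 11 * / 11) with 1 by (simpl; field).
    rewrite Rpower_1; lra.
Qed.

Theorem theorem1 :
  exists c : R, 0 < c /\
    forall (p1 p2 p3 : point) (P : list point),
      ~ collinear p1 p2 p3 ->
      NoDup P ->
      (1 <= length P)%nat ->
      ~ In p1 P -> ~ In p2 P -> ~ In p3 P ->
      c * Rpower (INR (length P)) (6 / 11)
        <= INR (num_distinct (dist_list p1 p2 p3 P)).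
Proof.
exists (/ 1504); split; [lra |].
intros p1 p2 p3 P Hcol HP Hn _ _ _.
unfold num_distinct; set (V := nodup Req_EM_T (dist_list p1 p2 p3 P)).
assert (HV0 : forall v, In v V -> 0 <= v).
{ intros v Hv; apply nodup_In, in_flat_map in Hv.
  destruct Hv as [q [_ [<-|[<-|[<-|[]]]]]]; apply sqrt_pos. }
assert (Hin : forall q, In q P -> In (dist p1 q) V /\ In (dist p2 q) V /\ In (dist p3 q) V).
{ intros q Hq; repeat split; apply nodup_In, in_flat_map; exists q; simpl; auto. }
assert (Ht : (1 <= length V)%nat).
{ destruct P as [|q P']; [simpl in Hn; lia |].
  destruct (Hin q (or_introl eq_refl)) as [Hq _].
  destruct V; [easy | simpl; lia]. }
destruct (cube_root_nat _ Ht) as [B [HB [HBt HtB]]].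
assert (Hcount := distances_count p1 p2 p3 P V B (8 * (B * B)) Hcol HP
  (NoDup_nodup _ _) HV0 HB HtB Hin).
set (n := length P) in *; set (t := length V) in *.
(* 752 = 16 * 17 + 30 * 16, where 17 bounds [2 * M + 1] by [17 * (B * B)] for [M = 8 * (B * B)]. *)
assert (Hle : (n * n <= t * (2 * n + 752 * (t * t * (B * B))))%nat).
{ apply Nat.le_trans with (1 := Hcount); apply Nat.mul_le_mono_l.
  assert (H1 : (2 * (8 * (B * B)) + 1 <= 17 * (B * B))%nat) by nia.
  assert (H2 := Nat.mul_le_mono_l _ _ (t * t * 16) H1); lia. }
apply (real_exponent_bound _ _ (INR B)).
- now apply (le_INR 1).
- now apply (le_INR 1).
- now apply (le_INR 1).
- rewrite <- !mult_INR; now apply le_INR.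
- apply le_INR in Hle.
  rewrite !mult_INR, plus_INR, !mult_INR in Hle.
  replace (INR 752) with 752 in Hle by (rewrite INR_IZR_INZ; reflexivity).
  replace (INR 2) with 2 in Hle by reflexivity.
  exact Hle.
Qed.
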